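(* For an integer $l \geq 3$, let $\epsilon_l$ be a root of the polynomial $X^3 + (l-1)X^2 - lX - 1 \in \mathbb{Z}[X]$, let $\mathbb{U}_l$ be the unit group of the ring of integers of the cubic field $\mathbb{Q}(\epsilon_l)$, and let $$j_l := \left(\mathbb{U}_l : \langle -1, \epsilon_l, \epsilon_l - 1\rangle\right)$$ be the index in $\mathbb{U}_l$ of the subgroup generated by $-1$, $\epsilon_l$ and $\epsilon_l - 1$. Then for any given prime $p \geq 3$, there are only finitely many $l \geq 3$ for which $p$ divides $j_l$. Hence, for any given integer $N \geq 2$, we have $\gcd(j_l, N!) = 1$ for all $l \geq l_N$, where $l_N$ is an effectively computable bound depending on $N$.
   Context: For $l \geq 3$ the polynomial $X^3 + (l-1)X^2 - lX - 1$ defines a non-Galois totally real cubic field $\mathbb{Q}(\epsilon_l)$; both $\epsilon_l$ and $\epsilon_l - 1$ are units of its ring of integers, and the unit group $\mathbb{U}_l$ has rank $2$, so the index $j_l$ is finite. *)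

(* Defs.v *)
From HB Require Import structures.
From mathcomp Require Import all_boot all_order all_algebra all_field.
From mathcomp Require Import finmap.
From mathcomp Require Import boolp classical_sets functions cardinality.

Set Implicit Arguments.
Unset Strict Implicit.
Unset Printing Implicit Defensive.

Import GRing.Theory Num.Theory.
Local Open Scope classical_set_scope.
Local Open Scope ring_scope.

Definition ennola_poly (l : nat) : {poly int} :=
  'X^3 + (l%:R - 1) *: 'X^2 - l%:R *: 'X - 1.

Definition is_eps (l : nat) (e : algC) : Prop :=
  root (map_poly intr (ennola_poly l)) e.

Definition generated_field (e : algC) : set algC :=
  smallest [set K : set algC | divring_closed (mem K)] [set e].

Definition integer_ring (e : algC) : set algC :=
  [set x | generated_field e x /\ x \in Aint].

Definition unit_group (e : algC) : set algC :=
  [set x | integer_ring e x /\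
           exists y : algC, integer_ring e y /\ x * y = 1].

(* Multiplicative subgroup of algC generated by G; as 0^-1 = 0, this is
   meant for sets G not containing 0. *)
Definition generated_subgroup (G : set algC) : set algC :=
  smallest [set H : set algC | divr_closed (mem H)] G.

Definition cosets (U H : set algC) : set (set algC) :=
  [set [set x * h | h in H] | x in U].

(* fset_set is fset0 on infinite sets, so an infinite index is 0. *)
Definition group_index (U H : set algC) : nat :=
  #|` fset_set (cosets U H)|.

Definition unit_index (e : algC) : nat :=
  group_index (unit_group e) (generated_subgroup [set -1; e; e - 1]).

(* General recursive functions: the smallest class containing the initial
   functions and closed under composition, primitive recursion and
   minimization of regular functions. *)
Inductive recursive : forall n : nat, (n.-tuple nat -> nat) -> Prop :=
| recursive_ext n (f g : n.-tuple nat -> nat) :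
    f =1 g -> recursive f -> recursive g
| recursive_zero n : recursive (fun _ : n.-tuple nat => 0%N)
| recursive_succ : recursive (fun v : 1.-tuple nat => (thead v).+1)
| recursive_proj n (i : 'I_n) : recursive (fun v : n.-tuple nat => tnth v i)
| recursive_comp m n (f : m.-tuple nat -> nat)
    (g : 'I_m -> n.-tuple nat -> nat) :
    recursive f -> (forall i, recursive (g i)) ->
    recursive (fun v : n.-tuple nat => f [tuple g i v | i < m])
| recursive_prim n (f : n.-tuple nat -> nat) (g : n.+2.-tuple nat -> nat) :
    recursive f -> recursive g ->
    recursive (fun v : n.+1.-tuple nat =>
      nat_rect (fun=> nat) (f [tuple of behead v])
        (fun k r => g [tuple of k :: r :: behead v]) (thead v))
| recursive_mu n (f : n.+1.-tuple nat -> nat)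
    (f_regular : forall v : n.-tuple nat,
       exists y, f [tuple of y :: v] == 0%N) :
    recursive f ->
    recursive (fun v : n.-tuple nat => ex_minn (f_regular v)).

Definition computable (f : nat -> nat) : Prop :=
  recursive (fun v : 1.-tuple nat => f (thead v)).

(* Main.v *)
Require Import Defs.
From HB Require Import structures.
From mathcomp Require Import all_boot all_order all_algebra all_field.
From mathcomp Require Import fingroup pgroup finmap.
From mathcomp Require Import boolp classical_sets functions cardinality.
From mathcomp Require Import ring lra zify.
Import Order.TTheory GRing.Theory Num.Theory.
Set Implicit Arguments.
Unset Strict Implicit.
Unset Printing Implicit Defensive.

(* Write [e] for the root of the polynomial. The roots are approximately [- 1 / l],
   [1 + 1 / l] and [- l], so the conjugates of the unit [e ^ I * (e - 1) ^ J] have sizes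
   about [l ^ - I], [l ^ - J] and [l ^ (I + J)].

   The index is finite: as [Tr (x ^ - 2)] is a positive integer, every unit [x] has a
   conjugate of absolute value at most 2, and as long as another one exceeds [10 l],
   multiplying [x] by the unit that moves one factor [l] from the largest conjugate to the
   small one decreases the positive integer [Tr (x ^ 2)]. So every coset contains a unit
   with bounded conjugates, and the traces of [x], [x e], [x e ^ 2], which determine [x],
   take finitely many values on those.

   If a prime [p] divides the index, Cauchy's theorem gives a unit [x] outside the
   subgroup with [x ^ p = +- e ^ a (e - 1) ^ b], and [a], [b] are not both divisible by
   [p]. Powers of [x] and elements of the subgroup allow one to replace [(a, b)] by
   any [(k a + p i, k b + p j)]. If [p] divides [a], [b] or [a + b], one can reach [(- p, 1)],
   [(1, - p)] or [(1, p - 1)], for which [|Tr x| = l + m / p + o(1)] with [m] prime to [p]: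
   this is not an integer. Otherwise one can reach both [(1 - p, B)] and [(A, 1 - p)] with
   [0 < A, B < p - 1]. With [lam = l ^ (1 / p)], both traces are, up to sign,
   [lam ^ (p - 1) + o(1)], hence they agree; but [p l] times their difference is
   [Q(lam) + o(1)] for an integer polynomial [Q] with bounded coefficients. Hence [Q = 0],
   although [2 p] does not divide [Q(1)]. All error terms are small enough as soon as
   [lam >= 10000 p ^ 2]. *)

(** * Powers and roots near 1 *)

Section NearOne.
Local Open Scope ring_scope.
Variable R : realFieldType.
Implicit Types (x z t w h d : R) (m n : int).

Lemma inv_ge_tangent z : 0 < z -> 2 - z <= z^-1.
Proof.
move=> z0; have zV : z * z^-1 = 1 by rewrite mulfV ?gt_eqF.
have : 0 <= z^-1 * (z - 1) ^+ 2 by rewrite mulr_ge0 ?sqr_ge0 // invr_ge0 ltW.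
have -> : z^-1 * (z - 1) ^+ 2 = z * z^-1 * z - 2 * (z * z^-1) + z^-1 by ring.
by rewrite zV; lra.
Qed.

Lemma bernoulli_exprz z m : 0 < z -> 1 + m%:~R * (z - 1) <= z ^ m.
Proof.
have bernoulli_exprn (x : R) k : 0 < x -> 1 + k%:R * (x - 1) <= x ^+ k.
  move=> x0; elim: k => [|k IH]; first by rewrite mul0r addr0 expr0.
  rewrite exprS; apply: le_trans (ler_wpM2l (ltW x0) IH).
  by rewrite -natr1; have := mulr_ge0 (ler0n R k) (sqr_ge0 (x - 1)); lra.
move=> z0; case: m => k; first exact: bernoulli_exprn.
rewrite NegzE -exprnN -exprVn; apply: le_trans (bernoulli_exprn _ _ _); last first.
  by rewrite invr_gt0.
have := ler_wpM2l (ler0n R k.+1) (inv_ge_tangent z0); rewrite mulrNz; lra.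
Qed.

Lemma inv_le_quadratic h : `|h| <= 1 / 2 -> (1 + h)^-1 <= 1 - h + 2 * h ^+ 2.
Proof.
rewrite ler_norml => /andP[h1 h2]; rewrite -[leLHS]div1r ler_pdivrMr; last lra.
by have := sqr_ge0 h; nra.
Qed.

Lemma exprz_near1 z m h : 0 < z -> m%:~R * (z - 1) = h -> `|h| <= 1 / 2 ->
  1 + h <= z ^ m <= 1 + h + 2 * h ^+ 2.
Proof.
move=> z0 hE h_small; rewrite -{1}hE bernoulli_exprz //=.
have := bernoulli_exprz (- m) z0; rewrite mulrNz mulNr hE -invr_expz => le_inv.
have := inv_le_quadratic (h := - h); rewrite normrN opprK sqrrN => /(_ h_small).
apply: le_trans; rewrite -[leLHS]invrK lef_pV2 // posrE ?invr_gt0 ?exprz_gt0 //.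
by move: h_small; rewrite ler_norml; lra.
Qed.

Lemma exprz_mul_near1 z t m n g h d :
  0 < z -> 0 < t -> m%:~R * (z - 1) = g -> n%:~R * (t - 1) = h ->
  `|g| <= d -> `|h| <= d -> d <= 1 / 10 ->
  `|z ^ m * t ^ n - (1 + (g + h))| <= 6 * d ^+ 2.
Proof.
move=> z0 t0 gE hE g_le h_le d_le; have d0 : 0 <= d by apply: le_trans g_le.
have err_le x k q : 0 < x -> k%:~R * (x - 1) = q -> `|q| <= d ->
    `|x ^ k - (1 + q)| <= 2 * d ^+ 2.
  move=> x0 qE q_le; have q_small : `|q| <= 1 / 2 by lra.
  have := exprz_near1 x0 qE q_small; have : q ^+ 2 <= d ^+ 2.
    by rewrite -real_normK ?num_real // lerXn2r ?nnegrE.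
  by rewrite ler_norml; have := sqr_ge0 d; lra.
move: (err_le _ _ _ z0 gE g_le) (err_le _ _ _ t0 hE h_le).
move: (z ^ m) (t ^ n) => Z T errZ errT.
have -> : Z * T - (1 + (g + h)) = g * h + (Z - (1 + g)) * (1 + h)
    + (T - (1 + h)) * (1 + g) + (Z - (1 + g)) * (T - (1 + h)) by ring.
have le_mul (a b A B : R) : `|a| <= A -> `|b| <= B -> `|a * b| <= A * B.
  by move=> *; rewrite normrM ler_pM.
have one_le (x : R) : `|x| <= d -> `|1 + x| <= 11 / 10 by rewrite !ler_norml; lra.
have d2 : d ^+ 2 <= 1 / 100 by nra.
have errT' : `|T - (1 + h)| <= 2 / 100 by lra.
have := le_mul _ _ _ _ g_le h_le; have := le_mul _ _ _ _ errZ (one_le _ h_le).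
have := le_mul _ _ _ _ errT (one_le _ g_le); have := le_mul _ _ _ _ errZ errT'.
by rewrite !ler_norml -expr2; have := sqr_ge0 d; lra.
Qed.

Lemma root_near1 p w h : (0 < p)%N -> 0 < w -> w ^+ p = 1 + h -> `|h| <= 1 / 2 ->
  `|w - (1 + h / p%:R)| <= 2 * h ^+ 2 / p%:R.
Proof.
move=> p_gt0 w0 wp h_small; have pR : 0 < p%:R :> R by rewrite ltr0n.
have upper : w - 1 <= h / p%:R.
  by rewrite ler_pdivlMr //; have := bernoulli_exprz p w0; rewrite -exprnP wp; lra.
have lower : 1 - w <= (2 * h ^+ 2 - h) / p%:R.
  rewrite ler_pdivlMr //; have := bernoulli_exprz p (_ : 0 < w^-1).
  rewrite invr_gt0 -exprnP exprVn wp => /(_ w0); have := inv_le_quadratic h_small.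
  by have := ler_wpM2l (ltW pR) (inv_ge_tangent w0); rewrite -pmulrn; lra.
have := divr_ge0 (sqr_ge0 h) (ltW pR).
by move: lower; rewrite mulrBl ler_norml; lra.
Qed.

Lemma root_exprz_mul_near1 p z t w m n g h d :
  (0 < p)%N -> 0 < z -> 0 < t -> 0 < w -> w ^+ p = z ^ m * t ^ n ->
  m%:~R * (z - 1) = g -> n%:~R * (t - 1) = h ->
  `|g| <= d -> `|h| <= d -> d <= 1 / 10 ->
  `|w - (1 + (g + h) / p%:R)| <= 20 * d ^+ 2 / p%:R.
Proof.
move=> p_gt0 z0 t0 w0 wp gE hE g_le h_le d_le.
have d0 : 0 <= d by apply: le_trans g_le.
have pV0 : 0 <= p%:R^-1 :> R by rewrite invr_ge0.
have := exprz_mul_near1 z0 t0 gE hE g_le h_le d_le; rewrite -wp => err.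
have k_le : `|w ^+ p - 1| <= 26 / 10 * d.
  have d2 : d ^+ 2 <= d / 10 by nra.
  by move: err g_le h_le; rewrite !ler_norml; lra.
have wpE : w ^+ p = 1 + (w ^+ p - 1) by ring.
have := root_near1 p_gt0 w0 wpE; move: (w ^+ p - 1) k_le wpE => k k_le wpE.
have k_small : `|k| <= 1 / 2 by lra.
have k2 : k ^+ 2 <= 7 * d ^+ 2 by move: k_le; rewrite ler_norml; nra.
move=> /(_ k_small); rewrite wpE in err.
have := ler_wpM2r pV0 k2; have := ler_wpM2r pV0 err.
rewrite -{1}(ger0_norm pV0) -normrM !ler_norml.
have := mulr_ge0 (sqr_ge0 d) pV0; lra.
Qed.

End NearOne.

Section Asymptotics.
Local Open Scope ring_scope.

Lemma normr_intr_le (R : numDomainType) (k : int) n :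
  (`|k| <= n)%N -> `|k%:~R| <= n%:R :> R.
Proof. by move=> k_le; rewrite -intr_norm -abszE pmulrn ler_nat. Qed.

Variable R : realFieldType.
Implicit Types (A B X Y M q c u : R) (a b al be k I J : int).

Definition asymp X M q c := `|X / M - (1 + q)| <= c.

Lemma asymp_dist X M q c : M != 0 -> asymp X M q c -> `|X - M * (1 + q)| <= `|M| * c.
Proof.
move=> M0 X_asymp; have -> : X - M * (1 + q) = M * (X / M - (1 + q)) by field.
by rewrite normrM ler_wpM2l.
Qed.

Lemma asymp_ratio_near1 u a X M : 0 <= u <= 1 / 100 -> `|a%:~R| <= 2 :> R ->
  asymp X M (a%:~R * u) (8 * u ^+ 2) -> `|X / M - 1| <= 3 * u.
Proof.
move=> /andP[u0 u1] a_le; have : `|a%:~R * u| <= 2 * u.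
  by rewrite normrM (ger0_norm u0) ler_wpM2r.
have u2_le : u ^+ 2 <= u / 100 by have := ler_wpM2l u0 u1; lra.
by rewrite /asymp !ler_norml; lra.
Qed.

Lemma ratio_gt0 u X M : 0 <= u <= 1 / 100 -> `|X / M - 1| <= 3 * u -> 0 < X / M.
Proof. by rewrite ler_norml; lra. Qed.

Lemma asymp_intr_mul a k u c X M : asymp X M (a%:~R * u) c ->
  `|k%:~R * (X / M - 1) - (a * k)%:~R * u| <= `|k%:~R| * c.
Proof.
move=> X_asymp; have -> : k%:~R * (X / M - 1) - (a * k)%:~R * u =
    k%:~R * (X / M - (1 + a%:~R * u)) by rewrite rmorphM /=; ring.
by rewrite normrM ler_wpM2l.
Qed.

Lemma radical_ratioX p lam A B X al be I J : lam != 0 -> X ^+ p = A ^ I * B ^ J ->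
  (X / lam ^ (al * I + be * J)) ^+ p =
    (A / (lam ^+ p) ^ al) ^ I * (B / (lam ^+ p) ^ be) ^ J.
Proof.
move=> lam0 Xp; have lamE : (lam ^ (al * I + be * J)) ^+ p =
    ((lam ^+ p) ^ al) ^ I * ((lam ^+ p) ^ be) ^ J.
  by rewrite !exprnP !exprz_exp -expfzDr //; congr (_ ^ _); ring.
by rewrite exprMn exprVn Xp lamE invfM !expfzMl !exprz_inv -!invr_expz mulrACA.
Qed.

End Asymptotics.

(** * Integer traces of radicals *)

Section RadicalTraces.
Local Open Scope ring_scope.

Lemma normr_horner_int_ge1 (R : realFieldType) (B x : R) (Q : {poly int}) :
  Q != 0 -> (forall i, `|(Q`_i)%:~R| <= B) -> B + 1 <= x ->
  1 <= `|(map_poly intr Q).[x]|.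
Proof.
move=> + + xB; have norm_ge1 (z : int) : z != 0 -> 1 <= `|z%:~R : R|.
  by move=> z0; rewrite -intr_norm ler1z -gtz0_ge1 normr_gt0.
elim/poly_ind: Q => [|Q c IH]; first by rewrite eqxx.
have [-> | Q0] := eqVneq Q 0.
  rewrite mul0r add0r polyC_eq0 => c0 _; rewrite map_polyC hornerC.
  exact: norm_ge1.
move=> _ coef_le; have Q_le i : `|(Q`_i)%:~R| <= B.
  by have := coef_le i.+1; rewrite coefD coefMX coefC addr0.
have c_le : `|c%:~R| <= B by have := coef_le 0; rewrite coefD coefMX coefC add0r.
have x1 : 1 <= x by have := normr_ge0 (c%:~R : R); lra.
have := IH Q0 Q_le; rewrite rmorphD rmorphM /= map_polyX map_polyC !hornerE /=.
set q := _.[x] => q1; have : `|q * x| <= `|q * x + c%:~R| + `|c%:~R|.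
  by rewrite -{1}(addrK c%:~R (q * x)) ler_normB.
rewrite normrM (ger0_norm (le_trans ler01 x1)).
have := ler_peMl (le_trans ler01 x1) q1; lra.
Qed.

Lemma intr_small_eq0 (R : numDomainType) (z : int) : `|z%:~R : R| < 1 -> z = 0.
Proof. by rewrite -intr_norm ltrz1 -[1]/(1%:Z) => h; apply/eqP; lia. Qed.

Variables (R : realFieldType) (p : nat) (lam : R).
Hypotheses (p_gt0 : (0 < p)%N) (lam_ge : 10000 * p%:R ^+ 2 <= lam).
Local Notation u := (lam ^+ p)^-1.
Implicit Types (X : 'I_3 -> R) (E K : 'I_3 -> int) (s : 'I_3 -> bool).

Let p1 : 1 <= p%:R :> R. Proof. by rewrite ler1n. Qed.

Let p_lam : 10000 * p%:R <= lam.
Proof. by apply: le_trans lam_ge; rewrite ler_pM2l // ler_eXnr. Qed.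

Lemma radix_gt0 : 0 < lam.
Proof. by apply: lt_le_trans p_lam; rewrite mulr_gt0 ?ltr0n. Qed.

Lemma radix_expr_mulV : lam ^+ p * u = 1.
Proof. by rewrite divff // expf_neq0 // gt_eqF // radix_gt0. Qed.

Let lam1 : 1 <= lam. Proof. by have := p_lam; have := p1; lra. Qed.
Let u_gt0 : 0 < u. Proof. by rewrite invr_gt0 exprn_gt0 // radix_gt0. Qed.
Let u_le : u <= lam^-1.
Proof. by rewrite lef_pV2 ?posrE ?exprn_gt0 ?radix_gt0 // ler_eXnr. Qed.
Let p2_le : p%:R ^+ 2 * lam^-1 <= 1 / 10000.
Proof. by rewrite ler_pdivrMr ?radix_gt0 //; move: lam_ge; lra. Qed.
Let p_le : p%:R * lam^-1 <= 1 / 10000.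
Proof. by rewrite ler_pdivrMr ?radix_gt0 //; move: p_lam; lra. Qed.

Lemma radix_small : p%:R * u <= 1 / 10000.
Proof. by apply: le_trans p_le; rewrite ler_pM2l ?ltr0n. Qed.

Lemma asymp_radical (A B X : R) (al be a b I J : int) :
  `|a%:~R| <= 2 :> R -> `|b%:~R| <= 2 :> R ->
  asymp A ((lam ^+ p) ^ al) (a%:~R * u) (8 * u ^+ 2) ->
  asymp B ((lam ^+ p) ^ be) (b%:~R * u) (8 * u ^+ 2) ->
  (`|I| <= p)%N -> (`|J| <= p)%N -> 0 < X -> X ^+ p = A ^ I * B ^ J ->
  asymp X (lam ^ (al * I + be * J)) ((a * I + b * J)%:~R / p%:R * u)
    (200 * p%:R * u ^+ 2).
Proof.
move=> a_le b_le A_asymp B_asymp I_le J_le X0 Xp.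
have pu : p%:R * u <= 1 / 100 by have := radix_small; lra.
have u_bound : 0 <= u <= 1 / 100 by rewrite ltW //= (le_trans _ pu) // ler_peMl // ltW.
have z1 := asymp_ratio_near1 u_bound a_le A_asymp.
have t1 := asymp_ratio_near1 u_bound b_le B_asymp.
have bound (k : int) z : (`|k| <= p)%N -> `|z - 1| <= 3 * u ->
    `|k%:~R * (z - 1)| <= 3 * (p%:R * u).
  by move=> k_le z_le; rewrite normrM mulrCA ler_pM // normr_intr_le.
have w0 : 0 < X / lam ^ (al * I + be * J) by rewrite divr_gt0 ?exprz_gt0 ?radix_gt0.
have := root_exprz_mul_near1 p_gt0 (ratio_gt0 u_bound z1) (ratio_gt0 u_bound t1) w0
  (radical_ratioX al be (lt0r_neq0 radix_gt0) Xp) erefl erefl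
  (bound _ _ I_le z1) (bound _ _ J_le t1).
move=> /(_ ltac:(lra)); rewrite /asymp; set w := X / _.
have main_term (k a' : int) Y M : (`|k| <= p)%N -> asymp Y M (a'%:~R * u) (8 * u ^+ 2) ->
    `|(k%:~R * (Y / M - 1) - (a' * k)%:~R * u) / p%:R| <= 8 * u ^+ 2.
  move=> k_le /(asymp_intr_mul k) err; rewrite normrM normfV normr_nat.
  rewrite ler_pdivrMr ?ltr0n // [leRHS]mulrC (le_trans err) //.
  rewrite ler_wpM2r ?normr_intr_le //.
  exact: mulr_ge0 (ler0n _ 8) (sqr_ge0 _).
have := main_term _ _ _ _ J_le B_asymp; have := main_term _ _ _ _ I_le A_asymp.
set g := _ * (A / _ - 1); set h := _ * (B / _ - 1) => g_err h_err w_err.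
have pn : p%:R != 0 :> R by rewrite pnatr_eq0 -lt0n.
have ln : lam ^+ p != 0 by rewrite expf_neq0 ?lt0r_neq0 ?radix_gt0.
have -> : w - (1 + (a * I + b * J)%:~R / p%:R * u) = (w - (1 + (g + h) / p%:R))
   + ((g - (a * I)%:~R * u) / p%:R + (h - (b * J)%:~R * u) / p%:R).
  by rewrite rmorphD /=; field; rewrite ln pn.
apply: le_trans (ler_normD _ _) _.
apply: le_trans (lerD w_err (le_trans (ler_normD _ _) (lerD g_err h_err))) _.
have -> : 20 * (3 * (p%:R * u)) ^+ 2 / p%:R = 180 * p%:R * u ^+ 2.
  by field; rewrite ln pn.
have : u ^+ 2 <= p%:R * u ^+ 2 by rewrite ler_peMl ?sqr_ge0.
have := sqr_ge0 u; lra.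
Qed.

Definition radical_family X E K := forall i, (`|K i| <= 3 * p)%N /\
  asymp (X i) (lam ^ E i) ((K i)%:~R / p%:R * u) (200 * p%:R * u ^+ 2).

Definition signed_trace X s (i0 : 'I_3) :=
  X i0 + \sum_(j | j != i0) (-1) ^+ s j * X j.

Section Family.
Variables (X : 'I_3 -> R) (E K : 'I_3 -> int).
Hypothesis X_radical : radical_family X E K.

Lemma radical_family_dist i : `|X i - lam ^ E i| <= 4 * u * lam ^ E i.
Proof.
have [K_le X_asymp] := X_radical i.
have lamE0 : 0 < lam ^ E i by rewrite exprz_gt0 ?radix_gt0.
have q_le : `|(K i)%:~R / p%:R * u| <= 3 * u.
  rewrite normrM (gtr0_norm u_gt0) ler_wpM2r ?(ltW u_gt0) // normrM normfV.
  by rewrite normr_nat ler_pdivrMr ?ltr0n // -natrM normr_intr_le.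
have err_le : 200 * p%:R * u ^+ 2 <= u.
  by rewrite expr2 mulrA ler_piMl ?(ltW u_gt0) // -mulrA; have := radix_small; lra.
have := asymp_dist (lt0r_neq0 lamE0) X_asymp; rewrite (gtr0_norm lamE0) => X_le.
have := ler_wpM2l (ltW lamE0) q_le; rewrite -[X in X * `|_|](gtr0_norm lamE0) -normrM.
have := ler_wpM2l (ltW lamE0) err_le; move: X_le.
by rewrite !ler_norml; lra.
Qed.

Lemma radical_family_small i : E i < 0 -> `|X i| <= 2 * lam^-1.
Proof.
move=> Ei; have lamE_le : lam ^ E i <= lam^-1.
  by rewrite -exprN1; apply: ler_weXz2l => //; lia.
have lamE0 : 0 <= lam ^ E i by rewrite exprz_ge0 // ltW ?radix_gt0.
have u4 : 4 * u <= 1 by have := ler_peMl (ltW u_gt0) p1; have := radix_small; lra.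
have := radical_family_dist i; have := ler_wpM2r lamE0 u4.
have := ler_normD (X i - lam ^ E i) (lam ^ E i); rewrite subrK (ger0_norm lamE0).
lra.
Qed.

Lemma signed_trace_near s i0 : (forall j, j != i0 -> E j < 0) ->
  `|signed_trace X s i0 - X i0| <= 4 * lam^-1.
Proof.
move=> E_lt0; rewrite /signed_trace addrC addKr.
apply: le_trans (ler_norm_sum _ _ _) _.
apply: (@le_trans _ _ (\sum_(j | j != i0) 2 * lam^-1)).
  by apply: ler_sum => j /E_lt0 Ej; rewrite normrM normr_sign mul1r radical_family_small.
by rewrite sumr_const cardC1 card_ord -mulr_natl /=; lra.
Qed.

Lemma subdominant_trace_near s i0 : E i0 = p.-1 -> (forall j, j != i0 -> E j < 0) ->
  `|signed_trace X s i0 - lam ^+ p.-1| <= 8 * lam^-1.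
Proof.
move=> Ei0 /(signed_trace_near s) near; have := radical_family_dist i0.
rewrite Ei0 -exprnP (_ : 4 * u * _ = 4 * lam^-1); last first.
  by rewrite -[in u](prednK p_gt0) exprS; field; rewrite expf_neq0 ?lt0r_neq0 ?radix_gt0.
by move: near; rewrite !ler_norml; lra.
Qed.

(* If the trace is [l + k / p] up to a quantity smaller than [1 / p], it can only be
   an integer when [p] divides [k]. *)
Lemma int_trace_dominant_dvd s i0 (L z : int) : lam ^+ p = L%:~R ->
  E i0 = p -> (forall j, j != i0 -> E j < 0) ->
  signed_trace X s i0 = z%:~R -> (p %| K i0)%Z.
Proof.
move=> lamL Ei0 E_lt0 zE; have near := signed_trace_near s E_lt0.
have l0 : 0 < lam ^+ p by rewrite exprn_gt0 ?radix_gt0.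
have [_] := X_radical i0; rewrite Ei0 -exprnP => /(asymp_dist (lt0r_neq0 l0)).
have -> : lam ^+ p * (1 + (K i0)%:~R / p%:R * u) = L%:~R + (K i0)%:~R / p%:R.
  by rewrite mulrDr mulr1 mulrCA radix_expr_mulV mulr1 lamL.
have -> : `|lam ^+ p| * (200 * p%:R * u ^+ 2) = 200 * p%:R * u.
  by rewrite (gtr0_norm l0) expr2; field; rewrite lt0r_neq0.
move=> X_le; have pn : p%:R != 0 :> R by rewrite pnatr_eq0 -lt0n.
suff : p%:Z * z - p%:Z * L - K i0 = 0.
  by move=> eq0; apply/dvdzP; exists (z - L); clear -eq0; lia.
apply: (intr_small_eq0 (R := R)); rewrite !rmorphB !rmorphM /= -zE -pmulrn.
set T := signed_trace X s i0 in near *.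
have -> : p%:R * T - p%:R * L%:~R - (K i0)%:~R =
    p%:R * ((T - X i0) + (X i0 - (L%:~R + (K i0)%:~R / p%:R))) by field.
rewrite normrM normr_nat; have := ler_wpM2l (ler0n R p) (lerD near X_le).
have := ler_wpM2l (ler0n R p) (ler_normD (T - X i0) (X i0 - (L%:~R + (K i0)%:~R / p%:R))).
have : p%:R * (200 * p%:R * u) <= 200 * (p%:R ^+ 2 * lam^-1).
  by have := ler_wpM2l (sqr_ge0 p%:R) u_le; lra.
by have := p2_le; have := p_le; lra.
Qed.

Let pl_gt0 : 0 < p%:R * lam ^+ p.
Proof. by rewrite mulr_gt0 ?ltr0n // exprn_gt0 ?radix_gt0. Qed.

Lemma leading_term_near i : E i = p.-1 ->
  `|p%:R * lam ^+ p * (X i - lam ^+ p.-1) - (K i)%:~R * lam ^+ p.-1| <=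
    200 * (p%:R ^+ 2 * lam^-1).
Proof.
move=> Ei; have lam_neq0 := lt0r_neq0 radix_gt0.
have pn : p%:R != 0 :> R by rewrite pnatr_eq0 -lt0n.
have [_] := X_radical i; rewrite Ei -exprnP => /(asymp_dist (expf_neq0 _ lam_neq0)).
rewrite (gtr0_norm (exprn_gt0 _ radix_gt0)) => /(ler_wpM2l (ltW pl_gt0)) X_le.
have -> : p%:R * lam ^+ p * (X i - lam ^+ p.-1) - (K i)%:~R * lam ^+ p.-1 =
    p%:R * lam ^+ p * (X i - lam ^+ p.-1 * (1 + (K i)%:~R / p%:R * u)).
  by field; rewrite pn expf_neq0.
rewrite normrM (gtr0_norm pl_gt0) (le_trans X_le) // le_eqVlt; apply/orP; left.
have lam_pred : lam ^+ p = lam * lam ^+ p.-1 by rewrite -exprS prednK.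
by apply/eqP; rewrite lam_pred; field; rewrite lam_neq0 expf_neq0.
Qed.

Lemma minor_term_near j : - p%:Z < E j < 0 ->
  `|p%:R * lam ^+ p * X j - p%:R * lam ^+ (absz (p%:Z + E j))| <= 4 * (p%:R * lam^-1).
Proof.
move=> /andP[Ej_gt Ej_lt0]; have lam_neq0 := lt0r_neq0 radix_gt0.
have -> : lam ^+ (absz (p%:Z + E j)) = lam ^+ p * lam ^ E j.
  by rewrite [lam ^+ p]exprnP -expfzDr // exprnP gez0_abs //; clear -Ej_gt; lia.
rewrite mulrA -mulrBr normrM (gtr0_norm pl_gt0).
apply: le_trans (ler_wpM2l (ltW pl_gt0) (radical_family_dist j)) _.
have -> : p%:R * lam ^+ p * (4 * u * lam ^ E j) = 4 * (p%:R * lam ^ E j).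
  by field; rewrite expf_neq0.
by rewrite !ler_pM2l ?ltr0n // -exprN1; apply: ler_weXz2l => //; clear -Ej_lt0; lia.
Qed.

(* [p l (T - lam ^ (p - 1))] is within [1 / 4] of the value at [lam] of this polynomial,
   when the trace [T] is dominated by a conjugate of size [lam ^ (p - 1)]. *)
Definition subdominant_poly s i0 : {poly int} :=
  K i0 *: 'X^(p.-1) + p%:Z *: \sum_(j | j != i0) (-1) ^+ s j *: 'X^(absz (p%:Z + E j)).

Lemma subdominant_poly_coef s i0 i : `|((subdominant_poly s i0)`_i)%:~R| <= 5 * p%:R :> R.
Proof.
have bool_le1 (b : bool) : b%:R <= 1 :> R by case: b.
rewrite /subdominant_poly coefD !coefZ coefXn coef_sum rmorphD !rmorphM /= rmorph_nat.
rewrite rmorph_sum /= -pmulrn; apply: le_trans (ler_normD _ _) _.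
rewrite !normrM !normr_nat.
have sum_le :
    `|\sum_(j | j != i0) (((-1) ^+ s j *: 'X^(absz (p%:Z + E j)))`_i)%:~R| <= 2 :> R.
  apply: le_trans (ler_norm_sum _ _ _) _.
  apply: (@le_trans _ _ (\sum_(j : 'I_3 | j != i0) 1)); last first.
    by rewrite sumr_const cardC1 card_ord.
  apply: ler_sum => j _; rewrite coefZ coefXn rmorphM rmorph_sign rmorph_nat /=.
  by rewrite normrM normr_sign mul1r normr_nat.
have [/(normr_intr_le R) K_le _] := X_radical i0.
have := ler_pM (normr_ge0 _) (ler0n _ _) K_le (bool_le1 (i == p.-1)).
have := ler_wpM2l (ler0n R p) sum_le; rewrite natrM; lra.
Qed.

Lemma subdominant_poly1_dvd s i0 : (2 * p%:Z %| (subdominant_poly s i0).[1] - K i0)%Z.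
Proof.
rewrite /subdominant_poly !hornerE /= expr1n mulr1 addrC addKr mulrC horner_sum.
have [z signs_even] : exists z, \sum_(j | j != i0) ((-1) ^+ s j : int) = z * 2.
  exists (\sum_(j | j != i0) - (s j)%:Z + 1).
  have sign_le (b : bool) : (-1) ^+ b = 1 + - b%:Z * 2 :> int by case: b.
  under eq_bigr do rewrite sign_le; rewrite big_split /= sumr_const cardC1 card_ord.
  by rewrite -mulr_suml mulrDl mul1r addrC.
under eq_bigr do rewrite !hornerE expr1n mulr1.
by rewrite signs_even -mulrA dvdz_mull.
Qed.

Lemma horner_subdominant_poly s i0 : (map_poly intr (subdominant_poly s i0)).[lam] =
  (K i0)%:~R * lam ^+ p.-1
    + p%:R * \sum_(j | j != i0) (-1) ^+ s j * lam ^+ (absz (p%:Z + E j)).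
Proof.
rewrite /subdominant_poly rmorphD /= !map_polyZ rmorph_sum /= !hornerE map_polyXn.
rewrite hornerXn horner_sum; congr (_ + _ * _); apply: eq_bigr => j _.
by rewrite map_polyZ map_polyXn !hornerE rmorph_sign.
Qed.

Lemma subdominant_poly_near s i0 : E i0 = p.-1 ->
  (forall j, j != i0 -> - p%:Z < E j < 0) ->
  `|p%:R * lam ^+ p * (signed_trace X s i0 - lam ^+ p.-1)
    - (map_poly intr (subdominant_poly s i0)).[lam]| <= 1 / 4.
Proof.
move=> Ei0 E_bound; have main := leading_term_near Ei0.
rewrite horner_subdominant_poly /signed_trace.
have -> (a b c d S T : R) : a * (b + S - c) - (d + p%:R * T) =
    a * (b - c) - d + (a * S - p%:R * T) by ring.
rewrite !mulr_sumr -sumrB; apply: le_trans (ler_normD _ _) _.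
apply: le_trans (lerD main (ler_norm_sum _ _ _)) _.
apply: (@le_trans _ _ (200 * (p%:R ^+ 2 * lam^-1)
    + \sum_(j | j != i0) 4 * (p%:R * lam^-1))).
  rewrite lerD2l; apply: ler_sum => j /E_bound Ej.
  by rewrite mulrCA [X in _ - X]mulrCA -mulrBr normrM normr_sign mul1r minor_term_near.
by rewrite sumr_const cardC1 card_ord -mulr_natl /=; have := p2_le; have := p_le; lra.
Qed.

End Family.

Lemma int_traces_subdominant_dvd X X' E E' K K' s s' i0 i0' (z : int) :
  radical_family X E K -> radical_family X' E' K' -> E i0 = p.-1 -> E' i0' = p.-1 ->
  (forall j, j != i0 -> - p%:Z < E j < 0) ->
  (forall j, j != i0' -> - p%:Z < E' j < 0) ->
  signed_trace X s i0 - signed_trace X' s' i0' = z%:~R ->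
  (2 * p%:Z %| K i0 - K' i0')%Z.
Proof.
move=> X_rad X'_rad Ei0 Ei0' E_bound E'_bound zE.
have E_lt0 j : j != i0 -> E j < 0 by move/E_bound/andP => [].
have E'_lt0 j : j != i0' -> E' j < 0 by move/E'_bound/andP => [].
have z0 : z = 0.
  apply: (intr_small_eq0 (R := R)); rewrite -zE.
  have lamV_ge0 : 0 <= lam^-1 by rewrite invr_ge0 ltW ?radix_gt0.
  have : 16 * lam^-1 < 1 by have := p_le; have := ler_peMl lamV_ge0 p1; lra.
  have := subdominant_trace_near X_rad s Ei0 E_lt0.
  have := subdominant_trace_near X'_rad s' Ei0' E'_lt0.
  by rewrite !ler_norml ltr_norml; lra.
set Q := subdominant_poly E K s i0 - subdominant_poly E' K' s' i0'.
have Q0 : Q = 0.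
  apply/eqP; apply: contraT => Q_neq0.
  have coef_le i : `|(Q`_i)%:~R| <= 10 * p%:R :> R.
    rewrite coefB rmorphB /=; apply: le_trans (ler_normB _ _) _.
    have := subdominant_poly_coef X_rad s i0 i.
    by have := subdominant_poly_coef X'_rad s' i0' i; lra.
  have lam_large : 10 * p%:R + 1 <= lam by have := p_lam; have := p1; lra.
  have := normr_horner_int_ge1 Q_neq0 coef_le lam_large.
  have := subdominant_poly_near X_rad s Ei0 E_bound.
  have := subdominant_poly_near X'_rad s' Ei0' E'_bound.
  move: zE; rewrite z0 => /eqP; rewrite subr_eq0 => /eqP ->.
  rewrite rmorphB /= hornerD hornerN; set a := _ * (_ - _).
  move=> near' near; rewrite leNgt => /negP[]; move: near near'.
  by rewrite !ler_norml ltr_norml; lra.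
have -> : K i0 - K' i0' = ((subdominant_poly E' K' s' i0').[1] - K' i0')
    - ((subdominant_poly E K s i0).[1] - K i0) + Q.[1].
  by rewrite /Q hornerD hornerN; ring.
by rewrite Q0 horner0 addr0 rpredB ?subdominant_poly1_dvd.
Qed.

End RadicalTraces.

(** * Number fields and their units *)

Section RootEmbedding.
Local Open Scope ring_scope.
Variables (h : {poly rat}) (h_irr : monic_irreducible_poly h).
Local Notation K := {poly %/ h with h_irr}.
Variables (F : numFieldType) (r : F).
Hypothesis r_root : root (map_poly ratr h) r.

Definition root_embedding of root (map_poly ratr h) r : K -> F :=
  fun k => (map_poly ratr (k : {poly rat})).[r].

Lemma horner_rmodp_root q :
  (map_poly ratr (Pdiv.Ring.rmodp q (mk_monic h))).[r] = (map_poly ratr q).[r].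
Proof.
rewrite -Pdiv.IdomainMonic.modpE ?monic_mk_monic // [in RHS](divp_eq q (mk_monic h)).
by rewrite rmorphD rmorphM /= !hornerE mk_monicE // (rootP r_root) mulr0 add0r.
Qed.

Fact root_embedding_is_zmod_morphism : zmod_morphism (root_embedding r_root).
Proof. by move=> x y; rewrite /root_embedding rmorphB /= !hornerE. Qed.

Fact root_embedding_is_monoid_morphism : monoid_morphism (root_embedding r_root).
Proof.
split=> [|x y]; first by rewrite /root_embedding rmorph1 hornerC.
by rewrite /root_embedding poly_of_qpolyM horner_rmodp_root rmorphM hornerM.
Qed.

HB.instance Definition _ := GRing.isZmodMorphism.Build K F (root_embedding r_root)
  root_embedding_is_zmod_morphism.
HB.instance Definition _ := GRing.isMonoidMorphism.Build K F (root_embedding r_root)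
  root_embedding_is_monoid_morphism.

Lemma root_embedding_gen : root_embedding r_root 'qX = r.
Proof. by rewrite /root_embedding horner_rmodp_root map_polyX hornerX. Qed.

Lemma root_embedding_coef k : root_embedding r_root k =
  \sum_(j < (size h).-1) ratr (k : {poly rat})`_j * r ^+ j.
Proof.
rewrite /root_embedding (@horner_coef_wide _ (size h).-1) => [|].
  by apply: eq_bigr => j _; rewrite coef_map.
have size_mk : size (mk_monic h) = size h by rewrite mk_monicE.
by rewrite size_map_poly -size_mk; exact: size_npoly.
Qed.

End RootEmbedding.

Section IntegralUnits.
Local Open Scope ring_scope.
Variables (L : fieldType) (f g : {rmorphism L -> algC}).

Lemma Aint_rmorph x : f x \in Aint -> g x \in Aint.
Proof.
move=> fx_int; have [P [PE _] _] := minCpolyP (f x).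
apply: (root_monic_Aint _ (minCpoly_monic (f x)) fx_int).
have horner_rmorph (k : {rmorphism L -> algC}) :
    (map_poly ratr P).[k x] = k (map_poly ratr P).[x].
  rewrite -horner_map -map_poly_comp; congr (_.[_]); apply: eq_map_poly => a /=.
  by rewrite fmorph_rat.
by have := root_minCpoly (f x); rewrite PE /root !horner_rmorph !fmorph_eq0.
Qed.

Definition integral_unit : pred L :=
  fun x => [&& x != 0, f x \in Aint & (f x)^-1 \in Aint].

Fact integral_unit_sdivr_closed : sdivr_closed integral_unit.
Proof.
split=> [|x y /and3P[x0 fx fxV] /and3P[y0 fy fyV]].
  by apply/and3P; rewrite rmorphN1 invrN1 rpredN1 oppr_eq0 oner_eq0.
by apply/and3P; rewrite mulf_neq0 ?invr_eq0 // fmorph_div invfM invrK !rpredM.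
Qed.

HB.instance Definition _ :=
  GRing.isSdivClosed.Build L integral_unit integral_unit_sdivr_closed.

End IntegralUnits.

Section UnitGroup.
Local Open Scope ring_scope.
Local Open Scope classical_set_scope.
Variables (h : {poly rat}) (h_irr : monic_irreducible_poly h) (e : algC).
Hypothesis e_root : root (map_poly ratr h) e.
Local Notation K := {poly %/ h with h_irr}.

Lemma generated_fieldE : generated_field e = range (root_embedding e_root : K -> algC).
Proof.
apply/seteqP; split.
  apply: smallest_sub => /= [|_ ->]; last by exists 'qX; rewrite ?root_embedding_gen.
  split=> [|_ _ /set_mem[j _ <-] /set_mem[k _ <-]|_ _ /set_mem[j _ <-] /set_mem[k _ <-]].
  - by apply: mem_set; exists 1; rewrite ?rmorph1.
  - by apply: mem_set; exists (j - k); rewrite ?rmorphB.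
  - by apply: mem_set; exists (j / k); rewrite ?fmorph_div.
move=> _ [k _ <-] S [S_divring /= eS]; apply: set_mem.
pose S' : divringClosed algC :=
  HB.pack (mem S : algC -> bool) (GRing.isDivringClosed.Build algC (mem S) S_divring).
apply: (@rpred_horner _ S'); last by apply: mem_set; apply: eS.
by apply/polyOverP => i; rewrite coef_map; apply: rpred_rat.
Qed.

Lemma unit_groupE : unit_group e = [set root_embedding e_root k |
  k in [set` integral_unit (root_embedding e_root : K -> algC)]].
Proof.
apply/seteqP; split=> x; rewrite /unit_group /integer_ring generated_fieldE.
  move=> [[[k _ <-] k_int] [y [[_ y_int] ky1]]]; exists k => //=.
  have k0 : root_embedding e_root k != 0.
    by apply: contra_eqN ky1 => /eqP->; rewrite mul0r eq_sym oner_eq0.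
  apply/and3P; rewrite -(fmorph_eq0 (root_embedding e_root)).
  by split=> //; rewrite -[_^-1]mulr1 -ky1 mulKf.
move=> [k /and3P[k0 k_int kV_int] <-]; split; first by split=> //; exists k.
exists (root_embedding e_root k^-1); rewrite fmorphV.
split; first by split=> //; exists k^-1; rewrite ?fmorphV.
by rewrite mulfV ?fmorph_eq0.
Qed.

End UnitGroup.

(** * The cubic field *)

Section EnnolaField.
Local Open Scope ring_scope.
Variable l : nat.

Definition ennola_rat : {poly rat} := map_poly intr (ennola_poly l).

Definition ennola_root (F : numFieldType) (x : F) := root (map_poly ratr ennola_rat) x.

Lemma map_ennola_rat (F : numFieldType) :
  map_poly ratr ennola_rat = map_poly intr (ennola_poly l) :> {poly F}.
Proof.
by rewrite /ennola_rat -map_poly_comp; apply: eq_map_poly => z /=; rewrite ratr_int.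
Qed.

Lemma ennola_root_eps (x : algC) : ennola_root x <-> is_eps l x.
Proof. by rewrite /ennola_root map_ennola_rat. Qed.

Lemma map_ennola_factored (F : comNzRingType) :
  map_poly intr (ennola_poly l) = 'X * ('X - 1) * ('X + l%:R%:P) - 1 :> {poly F}.
Proof.
have -> : ennola_poly l = 'X * ('X - 1) * ('X + l%:R%:P) - 1.
  by rewrite /ennola_poly -!mul_polyC rmorphB /=; ring.
by rewrite !(rmorphB, rmorphD, rmorphM) /= map_polyX rmorph1 !rmorph_nat.
Qed.

Lemma ennola_rootE (F : numFieldType) (x : F) :
  ennola_root x = (x * (x - 1) * (x + l%:R) == 1).
Proof.
by rewrite /ennola_root map_ennola_rat map_ennola_factored rootE !hornerE subr_eq0.
Qed.

Lemma ennola_root_neq01 (F : numFieldType) (x : F) :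
  ennola_root x -> (x != 0) && (x - 1 != 0).
Proof.
rewrite ennola_rootE -!negb_or -mulf_eq0; apply: contraTN => /eqP->.
by rewrite mul0r eq_sym oner_eq0.
Qed.

Let size_factored : size ('X * ('X - 1) * ('X + l%:R%:P) : {poly rat}) = 4.
Proof.
have addl_neq0 : 'X + l%:R%:P != 0 :> {poly rat} by rewrite -size_poly_eq0 size_XaddC.
rewrite size_mul ?mulf_neq0 ?polyX_eq0 ?polyXsubC_eq0 // size_XaddC.
by rewrite size_mul ?polyX_eq0 ?polyXsubC_eq0 // size_polyX size_XsubC.
Qed.

Lemma size_ennola_rat : size ennola_rat = 4.
Proof.
rewrite /ennola_rat map_ennola_factored.
by rewrite size_polyDl size_factored // size_polyN size_poly1.
Qed.

Lemma monic_ennola_rat : ennola_rat \is monic.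
Proof.
rewrite /ennola_rat map_ennola_factored monicE lead_coefDl; last first.
  by rewrite size_factored size_polyN size_poly1.
by rewrite !lead_coefM lead_coefX lead_coefXsubC lead_coefXaddC !mulr1.
Qed.

Lemma ennola_root_Aint (x : algC) : ennola_root x -> x \in Aint.
Proof.
move=> x_root; apply: (root_monic_Aint x_root).
  by rewrite map_monic monic_ennola_rat.
by apply/polyOverP => i; rewrite map_ennola_rat coef_map /= intr_int.
Qed.

Lemma ennola_irreducible : irreducible_poly ennola_rat.
Proof.
apply: cubic_irreducible => [|x]; first by rewrite size_ennola_rat.
apply/negP => x_root; have {}x_root : ennola_root (ratr x : algC).
  by rewrite /ennola_root fmorph_root.
have /intrP[z zE] : (ratr x : algC) \in Num.int.
  by rewrite Cint_rat_Aint ?Crat_rat ?ennola_root_Aint.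
move: x_root; rewrite ennola_rootE zE -[1]/(1%:~R) -[l%:R]/(l%:Z%:~R).
rewrite -rmorphB -rmorphD -!rmorphM /= eqr_int => /eqP z_root.
have : (z %| 1)%Z by apply/dvdzP; exists ((z - 1) * (z + l%:Z)); rewrite mulrC mulrA.
rewrite dvdz1 => z1; have [zE1|zE1] : z = 1 \/ z = -1 by clear -z1; lia.
  by move: z_root; rewrite zE1.
by move: z_root; rewrite zE1; clear; lia.
Qed.

Definition ennola_monic_irreducible : monic_irreducible_poly ennola_rat :=
  (ennola_irreducible, monic_ennola_rat).

Section Roots.
Variables (F : numFieldType) (r : 'I_3 -> F).
Hypotheses (r_inj : injective r) (r_root : forall i, ennola_root (r i)).

Lemma ennola_prod_XsubC :
  'X * ('X - 1) * ('X + l%:R%:P) - 1 = \prod_i ('X - (r i)%:P) :> {poly F}.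
Proof.
rewrite -map_ennola_factored -map_ennola_rat.
rewrite (@all_roots_prod_XsubC _ (map_poly ratr ennola_rat) (map r (enum 'I_3))).
- rewrite lead_coef_map (monicP monic_ennola_rat) rmorph1 scale1r big_map.
  by rewrite big_enum.
- by rewrite size_map_poly size_ennola_rat size_map size_enum_ord.
- by apply/allP => _ /mapP[i _ ->]; apply: r_root.
- by rewrite uniq_rootsE map_inj_uniq ?enum_uniq.
Qed.

Definition ennola_power_sum (j : nat) : rat := nth 0 [:: 3; 1 - l%:R; l%:R ^+ 2 + 1] j.

Lemma sum_ennola_rootsX (j : 'I_3) : \sum_i r i ^+ j = ratr (ennola_power_sum j).
Proof.
have eval c : c * (c - 1) * (c + l%:R) - 1 = \prod_i (c - r i).
  have := congr1 (horner^~ c) ennola_prod_XsubC; rewrite horner_prod !hornerE => ->.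
  by apply: eq_bigr => i _; rewrite !hornerE.
have := eval (-1); have := eval 1; have := eval 0; rewrite !big_ord_recl !big_ord0 /=.
set x := r _; set y := r _; set z := r _; rewrite !mulr1 !addr0 => at0 at1 atN1.
have sumE : x + (y + z) = 1 - l%:R.
  have -> : x + (y + z) = (2 * ((0 - x) * ((0 - y) * (0 - z)))
    - (1 - x) * ((1 - y) * (1 - z)) - (-1 - x) * ((-1 - y) * (-1 - z))) / 2 by field.
  by rewrite -at0 -at1 -atN1; field.
have sum_sqrE : x ^+ 2 + (y ^+ 2 + z ^+ 2) = l%:R ^+ 2 + 1.
  have -> : x ^+ 2 + (y ^+ 2 + z ^+ 2) = (x + (y + z)) ^+ 2
    - (1 - x) * ((1 - y) * (1 - z)) + (-1 - x) * ((-1 - y) * (-1 - z)) + 2 by ring.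
  by rewrite sumE -at1 -atN1; ring.
rewrite /ennola_power_sum.
case: j => -[|[|[|//]]] /= _; rewrite -/x -/y -/z ?expr1 ?expr0 ?sumE ?sum_sqrE.
- by rewrite rmorph_nat; ring.
- by rewrite rmorphB rmorph1 rmorph_nat.
- by rewrite rmorphD rmorphXn /= rmorph1 rmorph_nat.
Qed.

Local Notation K := {poly %/ ennola_rat with ennola_monic_irreducible}.
Implicit Types k : K.

Definition conjugate (i : 'I_3) : K -> F := root_embedding (r_root i).
HB.instance Definition _ i := GRing.RMorphism.on (conjugate i).

Lemma conjugate_gen i : conjugate i 'qX = r i.
Proof. exact: root_embedding_gen. Qed.

Lemma conjugate_coef i k :
  conjugate i k = \sum_(j < 3) ratr (k : {poly rat})`_j * r i ^+ j.
Proof. by rewrite /conjugate root_embedding_coef size_ennola_rat. Qed.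

Definition trace k := \sum_i conjugate i k.

Lemma trace_rat k : exists c : rat, trace k = ratr c.
Proof.
exists (\sum_(j < 3) (k : {poly rat})`_j * ennola_power_sum j).
rewrite /trace; under eq_bigr do rewrite conjugate_coef.
rewrite exchange_big rmorph_sum /=.
by apply: eq_bigr => j _; rewrite -mulr_sumr sum_ennola_rootsX rmorphM.
Qed.

Lemma traceB k k' : trace (k - k') = trace k - trace k'.
Proof. by rewrite /trace -sumrB; apply: eq_bigr => i _; rewrite rmorphB. Qed.

Lemma trace_nondegenerate k :
  (forall j : 'I_3, trace (k * 'qX ^+ j) = 0) -> k = 0.
Proof.
move=> tr0; apply/eqP; apply: contraT => k0.
have : trace (k / k) = 0.
  rewrite /trace; under eq_bigr do rewrite rmorphM /= (conjugate_coef _ k^-1) mulr_sumr.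
  rewrite exchange_big big1 //= => j _; set a := ratr _.
  transitivity (a * trace (k * 'qX ^+ j)); last by rewrite tr0 mulr0.
  rewrite mulr_sumr; apply: eq_bigr => i _.
  by rewrite mulrCA rmorphM rmorphXn /= conjugate_gen.
rewrite divff // /trace; under eq_bigr do rewrite rmorph1.
by rewrite sumr_const card_ord => /eqP; rewrite pnatr_eq0.
Qed.

Definition trace_vector k := (trace k, trace (k * 'qX), trace (k * 'qX ^+ 2)).

Lemma trace_vector_inj : injective trace_vector.
Proof.
move=> k k' [tr0 tr1 tr2]; apply/eqP; rewrite -subr_eq0; apply/eqP.
apply: trace_nondegenerate; case=> -[|[|[|//]]] /= _; rewrite mulrBl traceB;
  apply/eqP; rewrite subr_eq0; apply/eqP => //; by rewrite !mulr1.
Qed.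

End Roots.

End EnnolaField.

Section Trace.
Local Open Scope ring_scope.
Variables (l : nat) (e : algC) (r : 'I_3 -> algR).
Hypotheses (e_root : ennola_root l e).
Hypotheses (r_inj : injective r) (r_root : forall i, ennola_root l (r i)).
Local Notation K := {poly %/ ennola_rat l with ennola_monic_irreducible l}.

Lemma trace_int (k : K) : root_embedding e_root k \in Aint ->
  exists z : int, trace r_root k = z%:~R.
Proof.
move=> k_int; have [c sumE] := trace_rat r_inj r_root k.
have /intrP[z zE] : (ratr c : algC) \in Num.int.
  apply: Cint_rat_Aint; first exact: Crat_rat.
  rewrite -(fmorph_rat algRval) -sumE rmorph_sum /= rpred_sum // => i _.
  exact: (Aint_rmorph (algRval \o conjugate r_root i) k_int).
exists z; rewrite sumE; apply: (fmorph_inj algRval).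
by rewrite fmorph_rat zE rmorph_int.
Qed.

End Trace.

(** * The real places of the cubic field *)

(* The conjugates of [e ^ I * (e - 1) ^ J] have absolute values
   [l ^ weight I J i * (1 + slope I J i / l + O(1 / l ^ 2))]. *)
Definition weight (I J : int) (i : 'I_3) : int := (nth 0 [:: - I; - J; I + J] i)%R.
Definition slope (I J : int) (i : 'I_3) : int := (nth 0 [:: J - I; I - J *+ 2; J] i)%R.

Section RealRoots.
Local Open Scope ring_scope.
Variables (R : rcfType) (l : nat).
Hypothesis l_ge : (100 <= l)%N.
Local Notation L := (l%:R : R).
Local Notation u := (L^-1).

Lemma weight_linear I J i : weight I J i = weight 1 0 i * I + weight 0 1 i * J.
Proof. by rewrite /weight; case: i => -[|[|[|//]]] /= _; ring. Qed.

Lemma slope_linear I J i : slope I J i = slope 1 0 i * I + slope 0 1 i * J.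
Proof. by rewrite /slope; case: i => -[|[|[|//]]] /= _; ring. Qed.

Lemma slope_generator_le i : (`|slope 1 0 i| <= 2)%N /\ (`|slope 0 1 i| <= 2)%N.
Proof. by case: i => -[|[|[|//]]]. Qed.

Let L100 : 100 <= L. Proof. by rewrite ler_nat. Qed.
Let L0 : 0 < L. Proof. by have := L100; lra. Qed.
Let Lu : L * u = 1. Proof. by rewrite divff // lt0r_neq0. Qed.
Let u0 : 0 < u. Proof. by rewrite invr_gt0. Qed.
Let u1 : u <= 1 / 100. Proof. by rewrite -div1r ler_pdivrMr //; have := L100; lra. Qed.

Lemma ennola_ivt a b (f := fun x : R => x * (x - 1) * (x + L)) : a <= b ->
  (f a <= 1 <= f b) || (f b <= 1 <= f a) -> exists2 x, a <= x <= b & ennola_root l x.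
Proof.
move=> ab f_le; pose P := map_poly ratr (ennola_rat l) : {poly R}.
have P_eval c : P.[c] = f c - 1 by rewrite /P map_ennola_rat map_ennola_factored !hornerE.
case/orP: f_le => /andP[le1 ge1].
  have [|x] := poly_ivt ab (_ : P.[a] <= 0 <= P.[b]); last by exists x.
  by rewrite !P_eval subr_le0 subr_ge0 le1.
have [|x x_in] := poly_ivt ab (_ : (- P).[a] <= 0 <= (- P).[b]).
  by rewrite !hornerN !P_eval oppr_le0 oppr_ge0 subr_le0 subr_ge0 ge1.
by rewrite rootN; exists x.
Qed.

Definition real_place (i : 'I_3) x :=
  [/\ ennola_root l x,
      asymp `|x| (L ^ weight 1 0 i) ((slope 1 0 i)%:~R * u) (8 * u ^+ 2) &
      asymp `|x - 1| (L ^ weight 0 1 i) ((slope 0 1 i)%:~R * u) (8 * u ^+ 2)].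

Let u2_le : u ^+ 2 <= u / 100.
Proof. by have := ler_wpM2l (ltW u0) u1; lra. Qed.

Let u3_le : 8 * u ^+ 3 <= u ^+ 2.
Proof. by have := ler_wpM2r (sqr_ge0 u) u1; rewrite -exprS; have := sqr_ge0 u; lra. Qed.

Lemma ennola_root_near0 : exists2 x,
  - (u * (1 - u + 8 * u ^+ 2)) <= x <= - (u * (1 - u)) & ennola_root l x.
Proof.
have f_at a : - (u * a) * (- (u * a) - 1) * (- (u * a) + L) =
    a * (1 + u * a) * (1 - u ^+ 2 * a).
  have -> : 1 - u ^+ 2 * a = u * (L - u * a) by rewrite mulrBr [u * L]mulrC Lu; ring.
  by ring.
have := u0; have := u1; have := u2_le; move: (u) f_at => v f_at v2 v1 v0.
apply: ennola_ivt; rewrite /= ?f_at; first nra.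
by apply/orP; right; apply/andP; split; nra.
Qed.

Lemma real_place0 : exists2 x, - 1 < x <= 0 & real_place 0 x.
Proof.
have [x /andP[x_ge x_le] x_root] := ennola_root_near0.
have ua_ge0 : 0 <= u * (1 - u) by rewrite mulr_ge0 ?(ltW u0) //; have := u1; lra.
have x0 : x <= 0 by lra.
exists x; first by have := u1; have := u2_le; have := u3_le; have := u0; lra.
have scale a : L * (u * a) = a by rewrite mulrA Lu mul1r.
split; rewrite // /asymp /weight /slope /= ?subr0 ?exprN1 ?expr0z ?invrK ?divr1.
  rewrite (ler0_norm x0) ler_norml.
  have := ler_wpM2l (ltW L0) x_ge; have := ler_wpM2l (ltW L0) x_le.
  by rewrite !mulrN !scale; lra.
rewrite (ler0_norm (_ : x - 1 <= 0)) ?ler_norml; last lra.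
by have := u3_le; have := u0; lra.
Qed.

Lemma ennola_root_near1 : exists2 x,
  1 + u * (1 - 2 * u) <= x <= 1 + u * (1 - 2 * u + 8 * u ^+ 2) & ennola_root l x.
Proof.
have f_at a : (1 + u * a) * (1 + u * a - 1) * (1 + u * a + L) =
    a * (1 + u * a) * (1 + u + u ^+ 2 * a).
  have -> : 1 + u + u ^+ 2 * a = u * (1 + u * a + L).
    by rewrite mulrDr [u * L]mulrC Lu; ring.
  by ring.
have := u0; have := u1; have := u2_le; move: (u) f_at => v f_at v2 v1 v0.
apply: ennola_ivt; rewrite /= ?f_at; first nra.
by apply/orP; left; apply/andP; split; nra.
Qed.

Lemma real_place1 : exists2 x, 1 <= x & real_place 1 x.
Proof.
have [x /andP[x_ge x_le] x_root] := ennola_root_near1.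
have ua_ge0 : 0 <= u * (1 - 2 * u) by rewrite mulr_ge0 ?(ltW u0) //; have := u1; lra.
have x1 : 0 <= x - 1 by lra.
exists x; first by rewrite -subr_ge0.
have scale a : L * (u * a) = a by rewrite mulrA Lu mul1r.
split; rewrite // /asymp /weight /slope /= ?exprN1 ?expr0z ?invrK ?divr1.
  rewrite (ger0_norm (_ : 0 <= x)) ?ler_norml; last lra.
  by have := u3_le; have := u0; lra.
rewrite (ger0_norm x1) ler_norml.
have := ler_wpM2l (ltW L0) x_ge; have := ler_wpM2l (ltW L0) x_le.
by rewrite ![L * (1 + _)]mulrDr !scale; lra.
Qed.

Lemma ennola_root_nearNl : exists2 x, - L <= x <= u - L & ennola_root l x.
Proof.
apply: ennola_ivt; rewrite /= ?addNr ?mulr0 ?subrK ?ler01 /=; first by rewrite lerDr ltW.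
have -> : (u - L) * (u - L - 1) * u = (L * u - u ^+ 2) * (L + 1 - u) by ring.
have u2_le_half : u ^+ 2 <= 1 / 2 by have := u2_le; have := u1; lra.
have L_le : 2 <= L + 1 - u by have := L100; have := u1; lra.
rewrite Lu; apply/orP; left; apply: le_trans (_ : 1 / 2 * 2 <= _); first lra.
by apply: ler_pM => //; lra.
Qed.

Lemma real_place2 : exists2 x, x <= - 1 & real_place ord_max x.
Proof.
have [x /andP[x_ge x_le] x_root] := ennola_root_nearNl.
have x_le_N1 : x <= - 1 by have := L100; have := u1; lra.
exists x => //; have := ler_wpM2r (ltW u0) x_ge; have := ler_wpM2r (ltW u0) x_le.
rewrite mulNr mulrBl Lu => xu_le xu_ge.
split; rewrite // /asymp /weight /slope /= ?add0r ?addr0 ?expr1z.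
  by rewrite (ler0_norm (_ : x <= 0)) ?ler_norml; [have := sqr_ge0 u; lra | lra].
by rewrite (ler0_norm (_ : x - 1 <= 0)) ?ler_norml; [have := sqr_ge0 u; lra | lra].
Qed.

Definition real_places (r : 'I_3 -> R) := forall i, real_place i (r i).

Lemma exists_real_places : exists2 r : 'I_3 -> R, injective r & real_places r.
Proof.
have [x /andP[x_gt x_le] x_place] := real_place0.
have [y y_ge y_place] := real_place1; have [z z_le z_place] := real_place2.
exists (fun i : 'I_3 => nth 0 [:: x; y; z] i).
  have uniq_roots : uniq [:: x; y; z].
    have xy : x < y by apply: le_lt_trans x_le (lt_le_trans ltr01 y_ge).
    have zx : z < x by apply: le_lt_trans z_le x_gt.
    by rewrite /= !inE negb_or (lt_eqF xy) (gt_eqF zx) (gt_eqF (lt_trans zx xy)).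
  by move=> i j /eqP; rewrite nth_uniq // => /eqP/val_inj.
by move=> [[|[|[|//]]] i_lt]; [move: x_place | move: y_place | move: z_place];
  congr (real_place _ _); apply: val_inj.
Qed.

End RealRoots.

(** * Cauchy's theorem for groups of cosets *)

Lemma Cauchy_finType (T : finType) (mul : T -> T -> T) (one : T) (inv : T -> T) p :
  associative mul -> left_id one mul -> left_inverse one inv mul ->
  prime p -> p %| #|T| -> exists2 x, x <> one & iter p (mul x) one = one.
Proof.
move=> mulA mul1 mulV p_prime p_dvd.
pose G : finGroupType :=
  HB.pack T (Finite_isGroup.Axioms_ mul one inv mulA mul1 mulV).
have card_G : #|G| = #|T| by apply: (@bij_eq_card G T id); exists id.
have [|x _ x_order] := Cauchy (G := [set: G]%G) p_prime; first by rewrite cardsT card_G.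
exists (x : G) => [x1|].
  by move: p_prime; rewrite -x_order (_ : x = 1%g) // order1.
have iterE n : iter n (mul x) one = (x ^+ n)%g.
  by elim: n => [|n IH]; rewrite ?expg0 // expgS -IH.
by rewrite iterE -x_order expg_order.
Qed.

Section DivrClosedSet.
Local Open Scope ring_scope.
Local Open Scope classical_set_scope.

Lemma divr_closed_setP (F : unitRingType) (S : set F) :
  divr_closed (mem S) <-> S 1 /\ forall x y, S x -> S y -> S (x / y).
Proof.
split=> [[S1 Sdiv]|[S1 Sdiv]].
  by split=> [|x y Sx Sy]; apply: set_mem => //; apply: Sdiv; apply: mem_set.
split=> [|x y /set_mem Sx /set_mem Sy]; apply: mem_set => //; exact: Sdiv.
Qed.

Section Closure.
Variables (F : unitRingType) (S : set F).
Hypothesis S_closed : divr_closed (mem S).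

Lemma divr_closed_set1 : S 1.
Proof. by case/divr_closed_setP: S_closed. Qed.

Lemma divr_closed_setV x : S x -> S x^-1.
Proof. by case/divr_closed_setP: S_closed => S1 Sdiv Sx; rewrite -div1r; apply: Sdiv. Qed.

Lemma divr_closed_setM x y : S x -> S y -> S (x * y).
Proof.
case/divr_closed_setP: S_closed => _ Sdiv Sx Sy.
by rewrite -[y]invrK; apply: Sdiv => //; apply: divr_closed_setV.
Qed.

End Closure.

Section Cosets.
Variables U H : set algC.
Hypotheses (U_closed : divr_closed (mem U)) (H_closed : divr_closed (mem H)).
Hypotheses (U_neq0 : forall x, U x -> x != 0) (HU : H `<=` U).

Definition coset_of_set x : set algC := [set x * h | h in H].
Local Notation coset := coset_of_set.

Lemma mem_coset_of_set x : coset x x.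
Proof. by exists 1; [exact: divr_closed_set1 | rewrite mulr1]. Qed.

Lemma coset_of_set_mulr x h : H h -> h != 0 -> coset (x * h) = coset x.
Proof.
move=> Hh h0; apply/seteqP; split=> _ [k Hk <-].
  by exists (h * k); [exact: divr_closed_setM | rewrite mulrA].
exists (h^-1 * k); first by apply: divr_closed_setM => //; apply: divr_closed_setV.
by rewrite mulrA mulfK.
Qed.

Lemma coset_of_set_eq1 x : coset x = coset 1 -> H x.
Proof.
move=> xE; have [h Hh <-] : coset 1 x by rewrite -xE; exact: mem_coset_of_set.
by rewrite mul1r.
Qed.

Lemma coset_of_setM x y : [set a * b | a in coset x & b in coset y] = coset (x * y).
Proof.
apply/seteqP; split=> [_ [_ [h Hh <-] [_ [k Hk <-] <-]]|_ [h Hh <-]].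
  by exists (h * k); [exact: divr_closed_setM | rewrite mulrACA].
exists x; first exact: mem_coset_of_set.
by exists (y * h); [exists h | rewrite mulrA].
Qed.

Lemma coset_of_setV x : [set a^-1 | a in coset x] = coset x^-1.
Proof.
apply/seteqP; split=> [_ [_ [h Hh <-] <-]|_ [h Hh <-]].
  by exists h^-1; [exact: divr_closed_setV | rewrite invfM].
exists (x * h^-1); first by exists h^-1 => //; exact: divr_closed_setV.
by rewrite invfM invrK.
Qed.

Lemma Cauchy_group_index p : finite_set (cosets U H) -> prime p ->
  (p %| group_index U H)%N -> exists x, [/\ U x, ~ H x & H (x ^+ p)].
Proof.
move=> fin p_prime; rewrite /group_index cardfE; set T := fset_set _.
have mkP x : U x -> coset x \in T.
  by move=> Ux; rewrite in_fset_set // mem_set //; exists x.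
have repP (C : T) : exists2 x, U x & val C = coset x.
  by have := valP C; rewrite in_fset_set // => /set_mem[x Ux <-]; exists x.
have mulP (C D : T) : [set a * b | a in val C & b in val D] \in T.
  have [x Ux ->] := repP C; have [y Uy ->] := repP D.
  by rewrite coset_of_setM mkP //; exact: divr_closed_setM.
have invP (C : T) : [set a^-1 | a in val C] \in T.
  by have [x Ux ->] := repP C; rewrite coset_of_setV mkP //; exact: divr_closed_setV.
pose mul C D : T := FSetSub (mulP C D); pose inv C : T := FSetSub (invP C).
pose one : T := FSetSub (mkP _ (divr_closed_set1 U_closed)).
have mulA : associative mul.
  move=> C D E; apply: val_inj => /=.
  have [x Ux ->] := repP C; have [y Uy ->] := repP D; have [z Uz ->] := repP E.
  by rewrite !coset_of_setM mulrA.
have mul1 : left_id one mul.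
  move=> C; apply: val_inj => /=; have [x Ux ->] := repP C.
  by rewrite coset_of_setM mul1r.
have mulV : left_inverse one inv mul.
  move=> C; apply: val_inj => /=; have [x Ux ->] := repP C.
  by rewrite coset_of_setV coset_of_setM mulVf ?U_neq0.
case/(Cauchy_finType mulA mul1 mulV p_prime) => C C_neq1 Cp.
have [x Ux CE] := repP C; exists x; split=> //.
  move=> Hx; apply: C_neq1; apply: val_inj; rewrite CE /=.
  by rewrite -[x in LHS]mul1r coset_of_set_mulr // (U_neq0 (HU Hx)).
have iterE n : val (iter n (mul C) one) = coset (x ^+ n).
  by elim: n => [|n IH] //=; rewrite IH CE coset_of_setM exprS.
by apply: coset_of_set_eq1; rewrite -iterE Cp.
Qed.

End Cosets.

End DivrClosedSet.

(** * The units *)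

Section EnnolaUnits.
Local Open Scope ring_scope.
Local Open Scope classical_set_scope.

Definition ennola_monomial (F : fieldType) (t : F) (I J : int) := t ^ I * (t - 1) ^ J.

Lemma rmorph_ennola_monomial (F F' : fieldType) (f : {rmorphism F -> F'}) t I J :
  f (ennola_monomial t I J) = ennola_monomial (f t) I J.
Proof. by rewrite rmorphM /= !fmorphXz rmorphB rmorph1. Qed.

Lemma ennola_monomial_neq0 (F : fieldType) (t : F) I J :
  (t != 0) && (t - 1 != 0) -> ennola_monomial t I J != 0.
Proof. by case/andP=> t0 t1; rewrite mulf_neq0 ?expfz_neq0. Qed.

Lemma ennola_monomialM (F : fieldType) (t : F) I J I' J' : (t != 0) && (t - 1 != 0) ->
  ennola_monomial t (I + I') (J + J') = ennola_monomial t I J * ennola_monomial t I' J'.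
Proof. by case/andP=> t0 t1; rewrite /ennola_monomial !expfzDr // mulrACA. Qed.

Lemma ennola_monomialXz (F : fieldType) (t : F) I J m :
  ennola_monomial t (m * I) (m * J) = ennola_monomial t I J ^ m.
Proof. by rewrite /ennola_monomial expfzMl !exprz_exp ![m * _]mulrC. Qed.

Lemma generated_subgroup_divr_closed G : divr_closed (mem (generated_subgroup G)).
Proof.
apply/divr_closed_setP; split=> [S [/divr_closed_setP[] //]|x y Gx Gy S SG].
by have [/divr_closed_setP[_ Sdiv] _] := SG; apply: Sdiv; [exact: Gx | exact: Gy].
Qed.

Lemma generated_subgroupE (t : algC) : (t != 0) && (t - 1 != 0) ->
  generated_subgroup [set -1; t; t - 1] =
    [set x | exists (s : bool) I J, x = (-1) ^+ s * ennola_monomial t I J].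
Proof.
move=> /andP[t0 t1]; apply/seteqP; split=> [|_ [s [I [J ->]]] S [S_closed GS]].
  apply: smallest_sub => /=; last first.
    move=> _ [[->|->]|->] /=; rewrite /ennola_monomial.
    - by exists true, 0, 0; rewrite !expr0z !mulr1.
    - by exists false, 1, 0; rewrite expr0z expr1z mulr1 mul1r.
    - by exists false, 0, 1; rewrite expr0z expr1z !mul1r.
  apply/divr_closed_setP; split=> /= [|x y [s [I [J ->]]] [s' [I' [J' ->]]]].
    by exists false, 0, 0; rewrite /ennola_monomial !expr0z !mulr1.
  exists (s (+) s'), (I - I'), (J - J').
  by rewrite /ennola_monomial !expfzDr // !invfM -!invr_expz signr_addb invr_sign; ring.
pose S' : divClosed algC :=
  HB.pack (mem S : algC -> bool) (GRing.isDivClosed.Build algC (mem S) S_closed).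
have GS' x : [set -1; t; t - 1] x -> x \in S' by move=> Gx; apply: mem_set; apply: GS.
apply: set_mem; apply: (@rpredM _ S'); first by apply: rpredX; apply: GS'; left; left.
by apply: rpredM; apply: rpredXz; apply: GS'; [left; right | right].
Qed.

Variables (l : nat) (e : algC).
Hypothesis e_root : ennola_root l e.
Local Notation K := {poly %/ ennola_rat l with ennola_monic_irreducible l}.
Local Notation U := (unit_group e).
Local Notation H := (generated_subgroup [set -1; e; e - 1]).
Local Notation theta := ('qX : K).
Local Notation embed := (root_embedding e_root : K -> algC).
Local Notation unitK := (integral_unit embed).

Lemma qX_units : (theta \in unitK) && (theta - 1 \in unitK).
Proof.
have e_int := ennola_root_Aint e_root.
have /andP[e0 e1] := ennola_root_neq01 e_root.
have eE : e * (e - 1) * (e + l%:R) = 1 by apply/eqP; rewrite -ennola_rootE.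
have eVE : e^-1 = (e - 1) * (e + l%:R) by apply: (mulfI e0); rewrite mulfV // mulrA.
have e1VE : (e - 1)^-1 = e * (e + l%:R).
  by apply: (mulfI e1); rewrite mulfV // mulrCA mulrA.
have e1_int : e - 1 \in Aint by rewrite rpredB ?rpred1.
have el_int : e + l%:R \in Aint by rewrite rpredD ?rpred_nat.
have thetaE : root_embedding e_root theta = e := root_embedding_gen _ e_root.
have theta1E : root_embedding e_root (theta - 1) = e - 1.
  by rewrite rmorphB rmorph1 /= root_embedding_gen.
apply/andP; split; apply/and3P; rewrite -(fmorph_eq0 (root_embedding e_root)) /=.
  by rewrite thetaE e0 e_int eVE rpredM.
by rewrite theta1E e1 e1_int e1VE rpredM.
Qed.

Lemma qX_neq01 : (theta != 0) && (theta - 1 != 0).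
Proof. by have /andP[/and3P[-> _ _] /and3P[-> _ _]] := qX_units. Qed.

Lemma ennola_monomial_unit I J : ennola_monomial theta I J \in unitK.
Proof. by have /andP[th th1] := qX_units; rewrite rpredM ?rpredXz. Qed.

Lemma ennola_unit_groupE : U = [set embed k | k in [set` unitK]].
Proof. exact: unit_groupE. Qed.

Lemma unit_group_divr_closed : divr_closed (mem U).
Proof.
apply/divr_closed_setP; rewrite ennola_unit_groupE.
split=> [|_ _ [x xU <-] [y yU <-]].
  by exists 1; [exact: rpred1 | rewrite rmorph1].
by exists (x / y); [exact: rpred_div | rewrite fmorph_div].
Qed.

Lemma unit_group_neq0 x : U x -> x != 0.
Proof. by rewrite ennola_unit_groupE => -[k /and3P[k0 _ _] <-]; rewrite fmorph_eq0. Qed.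

Lemma generated_subgroup_sub : H `<=` U.
Proof.
rewrite (generated_subgroupE (ennola_root_neq01 e_root)) ennola_unit_groupE.
move=> _ [s [I [J ->]]]; exists ((-1) ^+ s * ennola_monomial theta I J).
  by apply: rpredM; [apply: rpredX; rewrite rpredN1 | exact: ennola_monomial_unit].
by rewrite rmorphM rmorphXn rmorphN1 rmorph_ennola_monomial /= root_embedding_gen.
Qed.

End EnnolaUnits.

(** * Finiteness of the index *)

Section Descent.
Local Open Scope ring_scope.

Lemma weighted_sum_decrease (R : realFieldType) (L : R) (a v : 'I_3 -> R) i k :
  100 <= L -> i != k -> (forall n, 0 <= a n <= a i) -> a k <= 4 -> 100 * L ^+ 2 < a i ->
  (forall n, v n <= 121 / 100 * (L ^ ((n == k)%:Z - (n == i)%:Z)) ^+ 2) ->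
  \sum_n a n * v n < \sum_n a n.
Proof.
move=> L_ge ik a_bound ak ai v_le; have ki : k != i by rewrite eq_sym.
have L2_ge : 10000 <= L ^+ 2 by have := ler_pM (ler0n _ 100) (ler0n _ 100) L_ge L_ge; lra.
have a0 n : 0 <= a n by case/andP: (a_bound n).
have term_i : a i * v i <= a i / 100.
  have vi : v i <= 121 / 100 * (L ^+ 2)^-1.
    by have := v_le i; rewrite eqxx (negPf ik) sub0r exprN1 exprVn.
  apply: ler_wpM2l => //; apply: le_trans vi _.
  by rewrite ler_pdivrMr; lra.
have term_k : a k * v k <= 484 / 100 * L ^+ 2.
  have vk : v k <= 121 / 100 * L ^+ 2.
    by have := v_le k; rewrite eqxx (negPf ki) subr0 expr1z.
  by have := ler_wpM2l (a0 k) vk; have := ler_wpM2r (sqr_ge0 L) ak; lra.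
have term_other n : (n != i) && (n != k) -> a n * v n <= a n + 21 / 100 * a i.
  case/andP=> ni nk; have := v_le n; rewrite (negPf ni) (negPf nk) subrr expr0z expr1n.
  by move/(ler_wpM2l (a0 n)); have /andP[_] := a_bound n; lra.
rewrite (bigD1 i) //= (bigD1 k) //= [ltRHS](bigD1 i) //= [X in _ < _ + X](bigD1 k) //=.
have := ler_sum (index_enum _) term_other; rewrite big_split sumr_const /=.
have : 21 / 100 * a i *+ #|[pred n | (n != i) && (n != k)]| <= 21 / 100 * a i * 3.
  rewrite -[leLHS]mulr_natr; apply: ler_wpM2l; first by have := a0 i; lra.
  by rewrite ler_nat; apply: leq_trans (max_card _) _; rewrite card_ord.
have := a0 k; have := a0 i; lra.
Qed.

Lemma exists_weight_transfer (i k : 'I_3) : exists I J : int,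
  [/\ (`|I| <= 1)%N, (`|J| <= 1)%N & forall n, weight I J n = (n == k)%:Z - (n == i)%:Z].
Proof.
exists ((0 == i)%:Z - (0 == k)%:Z), ((1 == i)%:Z - (1 == k)%:Z).
by case: i k => -[|[|[|//]]] i_lt [[|[|[|//]]] k_lt]; split=> //;
  case=> -[|[|[|//]]] n_lt.
Qed.

Lemma normr_exprz (R : numFieldType) (x : R) (n : int) : `|x ^ n| = `|x| ^ n.
Proof. by case: n => n; rewrite ?NegzE -?exprnN ?normfV normrX. Qed.

Lemma real_place_monomial_sqr_le (R : rcfType) l (x : R) i I J :
  (100 <= l)%N -> real_place l i x -> (`|I| <= 1)%N -> (`|J| <= 1)%N ->
  ennola_monomial x I J ^+ 2 <= 121 / 100 * (l%:R ^ weight I J i) ^+ 2.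
Proof.
move=> l_ge [_ x_asymp x1_asymp] I_le J_le; set u : R := l%:R^-1.
have l100 : 100 <= l%:R :> R by rewrite ler_nat.
have l0 : 0 < l%:R :> R by lra.
have u_le : 0 <= u <= 1 / 100.
  by rewrite invr_ge0 ltW //= -[leLHS]div1r ler_pdivrMr //; lra.
have [sl_le sl1_le] := slope_generator_le i.
have z1 := asymp_ratio_near1 u_le (normr_intr_le R sl_le) x_asymp.
have t1 := asymp_ratio_near1 u_le (normr_intr_le R sl1_le) x1_asymp.
have bound (k : int) (w : R) : (`|k| <= 1)%N -> `|w - 1| <= 3 * u ->
    `|k%:~R * (w - 1)| <= 3 / 100.
  move=> /(normr_intr_le R) k_le w_le; rewrite normrM.
  by have := ler_pM (normr_ge0 _) (normr_ge0 _) k_le w_le; lra.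
have := exprz_mul_near1 (ratio_gt0 u_le z1) (ratio_gt0 u_le t1) erefl erefl
  (bound _ _ I_le z1) (bound _ _ J_le t1) => /(_ ltac:(lra)).
set M := l%:R ^ weight I J i; set w := _ ^ I * _ ^ J => w_near.
have monomialE : `|ennola_monomial x I J| = w * M.
  rewrite normrM !normr_exprz /w /M (weight_linear I J) expfzDr ?lt0r_neq0 //.
  rewrite -!exprz_exp !expfzMl !exprz_inv -!invr_expz; field.
  by rewrite !expfz_neq0 // lt0r_neq0.
have /andP[w0 w_le] : 0 <= w <= 11 / 10.
  move: w_near (bound _ _ I_le z1) (bound _ _ J_le t1); rewrite !ler_norml; lra.
rewrite -real_normK ?num_real // monomialE exprMn ler_wpM2r ?sqr_ge0 //.
by have := ler_pM w0 w0 w_le w_le; rewrite -!expr2; lra.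
Qed.

End Descent.

Section FiniteIndex.
Local Open Scope ring_scope.
Local Open Scope classical_set_scope.

Lemma finite_bounded_ints (R : archiRealFieldType) (B : R) :
  finite_set [set (z%:~R : R) | z in [set z : int | `|z%:~R| <= B]].
Proof.
apply: finite_image; pose N := Num.bound `|B|.
apply: (@sub_finite_set _ _ [set n%:Z - N%:Z | n in `I_(2 * N)]); last first.
  by apply: finite_image; apply: finite_II.
move=> z /= z_le; have : (`|z| < N)%N.
  rewrite -(ltr_nat R) natr_absz intr_norm (le_lt_trans z_le) //.
  by rewrite (le_lt_trans (ler_norm B)) // archi_boundP.
by move=> z_lt; exists (absz (z + N%:Z)); clear -z_lt; lia.
Qed.

Variables (l : nat) (e : algC) (r : 'I_3 -> algR).
Hypotheses (l_ge : (100 <= l)%N) (e_root : ennola_root l e).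
Hypotheses (r_inj : injective r) (r_places : real_places l r).
Local Notation K := {poly %/ ennola_rat l with ennola_monic_irreducible l}.
Local Notation embed := (root_embedding e_root : K -> algC).
Local Notation unitK := (integral_unit embed).
Local Notation theta := ('qX : K).
Implicit Types k : K.

Lemma real_places_root i : ennola_root l (r i). Proof. by case: (r_places i). Qed.

Local Notation sigma := (conjugate real_places_root).
Local Notation tr := (trace real_places_root).

Lemma normr_trace_le k (B : algR) : (forall i, `|sigma i k| <= B) -> forall j : 'I_3,
  `|tr (k * 'qX ^+ j)| <= B * \sum_i \sum_(n < 3) `|r i| ^+ n.
Proof.
move=> k_le j; have B0 : 0 <= B by apply: le_trans (k_le 0).
rewrite mulr_sumr; apply: le_trans (ler_norm_sum _ _ _) _; apply: ler_sum => i _.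
rewrite rmorphM rmorphXn /= conjugate_gen normrM normrX; apply: ler_pM => //.
  by rewrite exprn_ge0.
by rewrite (bigD1 j) //= lerDl sumr_ge0 // => n _; rewrite exprn_ge0.
Qed.

Lemma finite_bounded_integers (B : algR) :
  finite_set [set k | embed k \in Aint /\ forall i, `|sigma i k| <= B].
Proof.
pose ints := [set (z%:~R : algR) |
  z in [set z : int | `|z%:~R| <= B * \sum_i \sum_(n < 3) `|r i| ^+ n]].
apply: (@sub_finite_set _ _
  (trace_vector real_places_root @^-1` (ints `*` ints `*` ints))).
  have gen_int j : embed 'qX ^+ j \in Aint.
    by rewrite root_embedding_gen rpredX ?(ennola_root_Aint e_root).
  move=> k [k_int k_le]; have tr_ints (j : 'I_3) : ints (tr (k * 'qX ^+ j)).
    have kj_int : embed (k * 'qX ^+ j) \in Aint by rewrite rmorphM rmorphXn /= rpredM.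
    have [z trE] := trace_int r_inj real_places_root kj_int.
    by exists z => //=; rewrite -trE normr_trace_le.
  split; [split|]; rewrite /=.
  - by have := tr_ints 0; rewrite expr0 mulr1.
  - by have := tr_ints 1; rewrite expr1.
  - exact: (tr_ints ord_max).
apply: finite_preimage; first by move=> ? ? _ _; apply: trace_vector_inj.
by do !apply: finite_setX; apply: finite_bounded_ints.
Qed.

Lemma trace_sqr_nat k : embed k \in Aint -> exists n, tr (k ^+ 2) = n%:R.
Proof.
move=> k_int; have k2_int : embed (k ^+ 2) \in Aint by rewrite rmorphXn /= rpredX.
have [z trE] := trace_int r_inj real_places_root k2_int.
exists `|z|%N; rewrite natr_absz ger0_norm // -(ler_int algR) -trE.
by apply: sumr_ge0 => i _; rewrite rmorphXn sqr_ge0.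
Qed.

Lemma exists_small_conjugate k : k \in unitK -> exists i, sigma i k ^+ 2 <= 4.
Proof.
case/and3P=> k0 _; rewrite -fmorphV => /trace_sqr_nat[n trE].
apply: contrapT => /forallNP large.
have inv_small i : sigma i (k^-1 ^+ 2) <= 4^-1.
  have /negP := large i; rewrite -ltNge => k_gt.
  by rewrite rmorphXn fmorphV exprVn lef_pV2 ?posrE ?(ltW k_gt) // (lt_trans _ k_gt).
have tr_lt1 : tr (k^-1 ^+ 2) < 1.
  apply: le_lt_trans (ler_sum _ (fun i _ => inv_small i)) _.
  by rewrite sumr_const card_ord -[ltLHS]mulr_natl ltr_pdivrMr // mul1r ltr_nat.
have tr_gt0 : 0 < tr (k^-1 ^+ 2).
  rewrite /trace (bigD1 0) //= ltr_wpDr //.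
    by apply: sumr_ge0 => i _; rewrite rmorphXn sqr_ge0.
  by rewrite rmorphXn exprn_even_gt0 //= fmorph_eq0 invr_eq0.
by move: tr_lt1 tr_gt0; rewrite trE ltrn1 ltr0n; case: (n).
Qed.

Lemma exists_trace_decrease k : k \in unitK ->
  (exists i, 100 * l%:R ^+ 2 < sigma i k ^+ 2) ->
  exists I J, tr ((k * ennola_monomial theta I J) ^+ 2) < tr (k ^+ 2).
Proof.
move=> k_unit [i0 i0_large]; have [j j_small] := exists_small_conjugate k_unit.
case: (arg_maxP (fun n => sigma n k ^+ 2) (erefl (xpredT i0))) => i _ i_max.
have i_large : 100 * l%:R ^+ 2 < sigma i k ^+ 2.
  exact: lt_le_trans i0_large (i_max _ _).
have ij : i != j.
  apply: contraTneq i_large => ->; rewrite -leNgt (le_trans j_small) //.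
  rewrite -natrX -natrM ler_nat (leq_trans _ (leq_pmulr _ _)) // expn_gt0.
  by rewrite (leq_trans _ l_ge).
have [I [J [I_le J_le weightE]]] := exists_weight_transfer i j; exists I, J.
rewrite /trace; under eq_bigr do rewrite exprMn rmorphM /=.
under [ltRHS]eq_bigr do rewrite rmorphXn /=.
under eq_bigr do rewrite !rmorphXn /=.
apply: (weighted_sum_decrease (L := l%:R) _ ij) => [|n|||n] //.
- by rewrite ler_nat.
- by rewrite sqr_ge0 /=; exact: i_max.
rewrite rmorph_ennola_monomial /= conjugate_gen -weightE.
exact: real_place_monomial_sqr_le.
Qed.

Lemma exists_bounded_representative k : k \in unitK -> exists I J,
  forall i, `|sigma i (k * ennola_monomial theta I J)| <= 10 * l%:R.
Proof.
move=> k_unit; have /and3P[_ k_int _] := k_unit.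
have [n trE] := trace_sqr_nat k_int.
elim/ltn_ind: n k k_unit {k_int} trE => n IH k k_unit trE.
have [large|small] := pselect (exists i, 100 * l%:R ^+ 2 < sigma i k ^+ 2).
  have [I [J lt_tr]] := exists_trace_decrease k_unit large.
  have k'_unit : k * ennola_monomial theta I J \in unitK.
    by rewrite rpredM ?ennola_monomial_unit.
  have /and3P[_ k'_int _] := k'_unit; have [m tr'E] := trace_sqr_nat k'_int.
  have [|I' [J' bounded]] := IH m _ _ k'_unit tr'E.
    by rewrite -(ltr_nat algR) -trE -tr'E.
  by exists (I + I'), (J + J') => i; rewrite ennola_monomialM ?(qX_neq01 e_root) // mulrA.
exists 0, 0 => i; rewrite /ennola_monomial !expr0z !mulr1.
rewrite -(@ler_pXn2r _ 2) ?nnegrE ?mulr_ge0 // real_normK ?num_real // exprMn.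
rewrite -natrX leNgt; apply/negP => large; apply: small; by exists i.
Qed.

Lemma finite_cosets :
  finite_set (cosets (unit_group e) (generated_subgroup [set -1; e; e - 1])).
Proof.
have e01 := ennola_root_neq01 e_root; set H := generated_subgroup _.
pose S := [set k | embed k \in Aint /\ forall i, `|sigma i k| <= 10 * l%:R].
apply: (@sub_finite_set _ _ [set coset_of_set H (embed k) | k in S]); last first.
  by apply: finite_image; exact: finite_bounded_integers.
move=> _ [x Ux <-]; move: Ux; rewrite (ennola_unit_groupE e_root) => -[k k_unit <-].
have [I [J bounded]] := exists_bounded_representative k_unit.
exists (k * ennola_monomial theta I J).
  have /and3P[_ k'_int _] : k * ennola_monomial theta I J \in unitK.
    by rewrite rpredM ?ennola_monomial_unit.
  by split.
rewrite rmorphM rmorph_ennola_monomial /= root_embedding_gen coset_of_set_mulr //.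
- exact: generated_subgroup_divr_closed.
- by rewrite /H generated_subgroupE //; exists false, I, J; rewrite mul1r.
- exact: ennola_monomial_neq0.
Qed.

End FiniteIndex.

(** * Prime divisors of the index *)

Section ExponentLattice.
Local Open Scope ring_scope.
Variables (p : nat) (P : int -> int -> Prop).
Hypothesis p_prime : prime p.
Hypothesis P_lin : forall a b k i j, P a b -> P (k * a + p%:Z * i) (k * b + p%:Z * j).

Lemma bezout_prime (a : int) : ~~ (p %| a)%Z -> exists k i : int, k * a + p%:Z * i = 1.
Proof.
move=> pa; have : coprimez a p%:Z by rewrite coprimezE coprime_sym prime_coprime.
by case/coprimezP => -[k i] /= E; exists k, i; rewrite (mulrC p%:Z).
Qed.

Lemma modz_mulinv_bound (m c d n : int) : m * c + p%:Z * n = 1 -> ~~ (p %| d)%Z ->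
  ~~ (p %| c + d)%Z -> 0 < (m * d %% p%:Z)%Z < p%:Z - 1.
Proof.
move=> mc pd pcd; have p0 : 0 < p%:Z by rewrite ltz_nat prime_gt0.
have cop : coprimez p%:Z m by apply/coprimezP; exists (n, c) => /=; rewrite -mc; ring.
have mdE := divz_eq (m * d) p%:Z; set D := (_ %% _)%Z in mdE *.
have D_ge0 : 0 <= D by rewrite modz_ge0 ?gt_eqF.
have D_lt : D < p%:Z by rewrite ltz_pmod.
have D_neq0 : D != 0.
  apply: contra pd => /eqP D0; rewrite -(Gauss_dvdzr _ cop) mdE D0 addr0.
  exact: dvdz_mull.
have D_neqN1 : D != p%:Z - 1.
  apply: contra pcd => /eqP D1; rewrite -(Gauss_dvdzr _ cop) mulrDr mdE D1.
  have -> : m * c = 1 - p%:Z * n by rewrite -mc; ring.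
  by apply/dvdzP; exists ((m * d %/ p%:Z)%Z + 1 - n); ring.
by clear -D_ge0 D_lt D_neq0 D_neqN1; lia.
Qed.

Lemma lattice_eq_modr a b k i x y q : P a b -> k * a + p%:Z * i = x ->
  k * b = y + q * p%:Z -> P x y.
Proof.
move=> Pab <- kb; rewrite (_ : y = k * b + p%:Z * - q); first exact: P_lin.
by rewrite kb; ring.
Qed.

Lemma lattice_eq_modl a b k j x y q : P a b -> k * b + p%:Z * j = y ->
  k * a = x + q * p%:Z -> P x y.
Proof.
move=> Pab <- ka; rewrite (_ : x = k * a + p%:Z * - q); first exact: P_lin.
by rewrite ka; ring.
Qed.

Hypotheses (notP_Np1 : ~ P (- p%:Z) 1) (notP_1Np : ~ P 1 (- p%:Z)).
Hypothesis notP_1p1 : ~ P 1 (p%:Z - 1).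
Hypothesis notP_pair : forall A B : int, 0 < A < p%:Z - 1 -> 0 < B < p%:Z - 1 ->
  P (1 - p%:Z) B -> ~ P A (1 - p%:Z).

Lemma exponent_lattice_dvd a b : P a b -> (p %| a)%Z /\ (p %| b)%Z.
Proof.
move=> Pab.
have [pa|pa] := boolP (p %| a)%Z; have [pb|pb] := boolP (p %| b)%Z => //; exfalso.
- have [k [j kb]] := bezout_prime pb; have /dvdzP[a' aE] := pa.
  by apply/notP_Np1/(lattice_eq_modl (q := k * a' + 1) Pab kb); rewrite aE; ring.
- have [k [i ka]] := bezout_prime pa; have /dvdzP[b' bE] := pb.
  by apply/notP_1Np/(lattice_eq_modr (q := k * b' + 1) Pab ka); rewrite bE; ring.
have [k [i ka]] := bezout_prime pa; have [k' [j kb]] := bezout_prime pb.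
have [/dvdzP[c cE]|pab] := boolP (p %| a + b)%Z.
  apply/notP_1p1/(lattice_eq_modr (q := k * c + i - 1) Pab ka).
  have kaE : k * a = 1 - p%:Z * i by rewrite -ka; ring.
  have -> : k * b = k * (a + b) - k * a by ring.
  by rewrite cE kaE; ring.
have pba : ~~ (p %| b + a)%Z by rewrite addrC.
apply: (notP_pair (modz_mulinv_bound kb pa pba) (modz_mulinv_bound ka pb pab)).
  apply: (lattice_eq_modr (i := i - 1) (k := k) (q := (k * b %/ p%:Z)%Z) Pab).
    by rewrite mulrBr addrA ka mulr1.
  by rewrite addrC -divz_eq.
apply: (lattice_eq_modl (j := j - 1) (k := k') (q := (k' * a %/ p%:Z)%Z) Pab).
  by rewrite mulrBr addrA kb mulr1.
by rewrite addrC -divz_eq.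
Qed.

End ExponentLattice.

Section PrimeIndex.
Local Open Scope ring_scope.
Local Open Scope classical_set_scope.

Lemma exists_nonneg_root (R : rcfType) n (a : R) : (0 < n)%N -> 0 <= a ->
  exists2 x, 0 <= x & x ^+ n = a.
Proof.
move=> n_gt0 a0; have [||x /andP[x0 _] /rootP] := @poly_ivt R ('X^n - a%:P) 0 (1 + a).
- by rewrite addr_ge0.
- rewrite !hornerE expr0n gtn_eqF //= sub0r oppr_le0 a0 subr_ge0.
  by rewrite (le_trans _ (ler_eXnr n_gt0 _)) ?lerDr ?lerDl.
by rewrite !hornerE => /eqP; rewrite subr_eq0 => /eqP; exists x.
Qed.

Lemma rmorph_real_root_unity (F : fieldType) (R : realFieldType) (f : {rmorphism F -> R})
    (x : F) n (s : bool) :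
  (0 < n)%N -> x ^+ n = (-1) ^+ s -> exists t : bool, x = (-1) ^+ t.
Proof.
move=> n_gt0 xn; exists (f x < 0); apply: (fmorph_inj f); rewrite rmorph_sign.
have norm1 : `|f x| = 1.
  by apply/eqP; rewrite -(pexpr_eq1 n_gt0) // -normrX -rmorphXn xn rmorph_sign normr_sign.
by rewrite [LHS]numEsign norm1 mulr1.
Qed.

Variables (p l : nat) (e : algC) (r : 'I_3 -> algR) (lam : algR).
Hypotheses (p_prime : prime p) (l_ge : (100 <= l)%N).
Hypotheses (lam_ge : 10000 * p%:R ^+ 2 <= lam) (lamE : lam ^+ p = l%:R).
Hypotheses (e_root : ennola_root l e) (r_inj : injective r) (r_places : real_places l r).
Local Notation K := {poly %/ ennola_rat l with ennola_monic_irreducible l}.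
Local Notation theta := ('qX : K).
Local Notation unitK := (integral_unit (root_embedding e_root : K -> algC)).
Local Notation sigma := (conjugate (real_places_root r_places)).

Let p_gt0 : (0 < p)%N := prime_gt0 p_prime.

(* [e ^ I * (e - 1) ^ J] is, up to sign, the [p]-th power of a unit. *)
Definition radical_exponent (I J : int) := exists2 k : K, k \in unitK &
  exists s : bool, k ^+ p = (-1) ^+ s * ennola_monomial theta I J.

Lemma radical_exponent_lin a b m i j : radical_exponent a b ->
  radical_exponent (m * a + p%:Z * i) (m * b + p%:Z * j).
Proof.
move=> [k k_unit [s kp]]; exists (k ^ m * ennola_monomial theta i j).
  by rewrite rpredM ?rpredXz ?ennola_monomial_unit.
have [t tE] : exists t : bool, ((-1) ^+ s : K) ^ m = (-1) ^+ t.
  case: s {kp}; last by exists false; rewrite expr0 exp1rz.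
  rewrite expr1; case: m => m; first by exists (odd m); rewrite signr_odd.
  by exists (odd m.+1); rewrite NegzE -exprnN invr_sign signr_odd.
exists t; rewrite exprMn [(k ^ m) ^+ p]exprnP exprzAC -exprnP kp expfzMl tE.
rewrite [ennola_monomial theta i j ^+ p]exprnP -!ennola_monomialXz.
by rewrite ennola_monomialM ?(qX_neq01 e_root) // -mulrA.
Qed.

Lemma radical_conjugate_family I J k (s : bool) : (`|I| <= p)%N -> (`|J| <= p)%N ->
  k != 0 -> k ^+ p = (-1) ^+ s * ennola_monomial theta I J ->
  radical_family p lam (fun i => `|sigma i k|) (weight I J) (slope I J).
Proof.
move=> I_le J_le k0 kp i; split.
  by rewrite /slope; case: i => -[|[|[|//]]] /= _; clear -I_le J_le; lia.
have [_] := r_places i; rewrite -lamE => r_asymp r1_asymp.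
have [/(normr_intr_le algR) sl_le /(normr_intr_le algR) sl1_le] := slope_generator_le i.
rewrite weight_linear slope_linear.
apply: (asymp_radical p_gt0 lam_ge sl_le sl1_le r_asymp r1_asymp I_le J_le).
  by rewrite normr_gt0 fmorph_eq0.
rewrite -normrX -rmorphXn kp rmorphM rmorphXn rmorphN1 /= normrM normr_sign mul1r.
by rewrite rmorph_ennola_monomial /= conjugate_gen normrM !normr_exprz.
Qed.

Lemma radical_signed_trace I J i0 : (`|I| <= p)%N -> (`|J| <= p)%N ->
  radical_exponent I J -> exists X s (z : int),
  radical_family p lam X (weight I J) (slope I J) /\ signed_trace X s i0 = z%:~R.
Proof.
move=> I_le J_le [k k_unit [s kp]]; have /and3P[k0 k_int _] := k_unit.
have [z trE] := trace_int r_inj (real_places_root r_places) k_int.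
pose neg i := sigma i k < 0.
exists (fun i => `|sigma i k|), (fun j => neg i0 (+) neg j), ((-1) ^+ neg i0 * z).
split; first exact: radical_conjugate_family kp.
rewrite /signed_trace rmorphM rmorph_sign /= -trE /trace [X in _ = _ * X](bigD1 i0) //=.
rewrite mulrDr normrEsign; congr (_ + _); rewrite mulr_sumr; apply: eq_bigr => j _.
by rewrite signr_addb -mulrA mulr_sign_norm.
Qed.

Lemma dominant_radical_dvd I J i0 : (`|I| <= p)%N -> (`|J| <= p)%N ->
  weight I J i0 = p -> (forall j, j != i0 -> weight I J j < 0) ->
  radical_exponent I J -> (p %| slope I J i0)%Z.
Proof.
move=> I_le J_le W_i0 W_lt0 /(radical_signed_trace i0 I_le J_le)[X [s [z [X_rad zE]]]].
have lamZ : lam ^+ p = l%:Z%:~R by rewrite lamE.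
exact: (int_trace_dominant_dvd p_gt0 lam_ge X_rad lamZ W_i0 W_lt0 zE).
Qed.

Lemma subdominant_radicals_dvd I J I' J' i0 i0' :
  (`|I| <= p)%N -> (`|J| <= p)%N -> (`|I'| <= p)%N -> (`|J'| <= p)%N ->
  weight I J i0 = p.-1 -> (forall j, j != i0 -> - p%:Z < weight I J j < 0) ->
  weight I' J' i0' = p.-1 -> (forall j, j != i0' -> - p%:Z < weight I' J' j < 0) ->
  radical_exponent I J -> radical_exponent I' J' ->
  (2 * p%:Z %| slope I J i0 - slope I' J' i0')%Z.
Proof.
move=> I_le J_le I'_le J'_le W_i0 W_lt0 W'_i0 W'_lt0.
move=> /(radical_signed_trace i0 I_le J_le)[X [s [z [X_rad zE]]]].
move=> /(radical_signed_trace i0' I'_le J'_le)[X' [s' [z' [X'_rad z'E]]]].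
have traceE : signed_trace X s i0 - signed_trace X' s' i0' = (z - z')%:~R.
  by rewrite zE z'E rmorphB.
exact: (int_traces_subdominant_dvd p_gt0 lam_ge X_rad X'_rad W_i0 W'_i0
  W_lt0 W'_lt0 traceE).
Qed.

Lemma radical_exponent_dvd a b : radical_exponent a b -> (p %| a)%Z /\ (p %| b)%Z.
Proof.
have p2 := prime_gt1 p_prime.
have ndvd_offset (m d : int) (c : bool) : d = m * p%:Z + (-1) ^+ c -> ~ (p %| d)%Z.
  move=> ->; rewrite rpredDl ?dvdz_mull // dvdzE abszX exp1n dvdn1 => /eqP /= p1.
  by rewrite p1 in p2.
apply: (exponent_lattice_dvd p_prime radical_exponent_lin).
- move=> rad.
  apply: (ndvd_offset 1 _ false) (dominant_radical_dvd (i0 := 0) _ _ _ _ rad);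
    try by rewrite /weight /slope /=; clear -p2; lia.
  by case=> -[|[|[|//]]] ? //= _; rewrite /weight /=; clear -p2; lia.
- move=> rad.
  apply: (ndvd_offset 2 _ false) (dominant_radical_dvd (i0 := 1) _ _ _ _ rad);
    try by rewrite /weight /slope /=; clear -p2; lia.
  by case=> -[|[|[|//]]] ? //= _; rewrite /weight /=; clear -p2; lia.
- move=> rad.
  apply: (ndvd_offset 1 _ true) (dominant_radical_dvd (i0 := ord_max) _ _ _ _ rad);
    try by rewrite /weight /slope /=; clear -p2; lia.
  by case=> -[|[|[|//]]] ? //= _; rewrite /weight /=; clear -p2; lia.
move=> A B A_bound B_bound radB radA.
have : (2 * p%:Z %| slope (1 - p%:Z) B 0%R - slope A (1 - p%:Z) 1%R)%Z.
  apply: subdominant_radicals_dvd radB radA;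
    try by rewrite /weight /=; clear -p2 A_bound B_bound; lia.
    by case=> -[|[|[|//]]] ? //= _; rewrite /weight /=; clear -p2 A_bound B_bound; lia.
  by case=> -[|[|[|//]]] ? //= _; rewrite /weight /=; clear -p2 A_bound B_bound; lia.
rewrite dvdzE /slope /= => /dvdn_leq; clear -p2 A_bound B_bound; lia.
Qed.

Lemma prime_ndvd_unit_index_real_places : ~ (p %| unit_index e)%N.
Proof.
have H_closed := generated_subgroup_divr_closed [set -1; e; e - 1].
have e01 := ennola_root_neq01 e_root.
move=> /(Cauchy_group_index (unit_group_divr_closed e_root) H_closed
  (@unit_group_neq0 _ _ e_root) (generated_subgroup_sub e_root)
  (finite_cosets l_ge e_root r_inj r_places) p_prime)[x []].
rewrite (ennola_unit_groupE e_root) => -[k k_unit <-] notH.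
rewrite (generated_subgroupE e01) => -[s [I [J kpE]]]; apply: notH.
have kp : k ^+ p = (-1) ^+ s * ennola_monomial theta I J.
  apply: (fmorph_inj (root_embedding e_root)); rewrite rmorphXn kpE.
  by rewrite rmorphM rmorphXn rmorphN1 rmorph_ennola_monomial /= root_embedding_gen.
have [|/dvdzP[I' IE] /dvdzP[J' JE]] := @radical_exponent_dvd I J.
  by exists k => //; exists s.
have g0 : ennola_monomial theta I' J' != 0 := ennola_monomial_neq0 _ _ (qX_neq01 e_root).
have [t kE] : exists t : bool, k / ennola_monomial theta I' J' = (-1) ^+ t.
  apply: (rmorph_real_root_unity (sigma 0) p_gt0 (s := s)).
  rewrite exprMn exprVn kp IE JE ![_ * p%:Z]mulrC ennola_monomialXz -exprnP.
  by rewrite mulfK ?expf_neq0.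
rewrite (generated_subgroupE e01); exists t, I', J'.
rewrite -(divfK g0 k) kE rmorphM rmorphXn rmorphN1 rmorph_ennola_monomial /=.
by rewrite root_embedding_gen.
Qed.

End PrimeIndex.

Definition index_bound (N : nat) : nat := (10000 * N ^ 2) ^ N.

Lemma leq_index_bound m n : 0 < m <= n -> index_bound m <= index_bound n.
Proof.
move=> /andP[m_gt0 mn]; have n_gt0 := leq_trans m_gt0 mn.
apply: (@leq_trans ((10000 * n ^ 2) ^ m)).
  by rewrite leq_exp2r // leq_mul2l leq_exp2r // mn orbT.
by rewrite leq_pexp2l // muln_gt0 expn_gt0 n_gt0.
Qed.

Section LargePrimeIndex.
Local Open Scope ring_scope.

Lemma prime_ndvd_unit_index p l e : prime p -> (index_bound p <= l)%N ->
  ennola_root l e -> ~ (p %| unit_index e)%N.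
Proof.
move=> p_prime l_ge e_root; have p_gt0 := prime_gt0 p_prime.
have l100 : (100 <= l)%N.
  by apply: leq_trans l_ge; apply: (@leq_trans (index_bound 1)); rewrite ?leq_index_bound.
have [lam lam0 lamE] : exists2 lam : algR, 0 <= lam & lam ^+ p = l%:R.
  exact: exists_nonneg_root.
have lam_ge : 10000 * p%:R ^+ 2 <= lam.
  rewrite -(@ler_pXn2r _ p) ?nnegrE //; last by rewrite mulr_ge0 // exprn_ge0.
  by rewrite lamE -natrX -natrM -natrX ler_nat.
have [r r_inj r_places] := exists_real_places algR l100.
exact: (prime_ndvd_unit_index_real_places p_prime l100 lam_ge lamE e_root r_inj r_places).
Qed.

End LargePrimeIndex.

(** * Computability of the bound *)

Section Computability.

Definition computable2 (f : nat -> nat -> nat) :=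
  recursive (fun v : 2.-tuple nat => f (tnth v ord0) (tnth v ord_max)).

Lemma recursive_comp1 n (f : nat -> nat) (g : n.-tuple nat -> nat) :
  computable f -> recursive g -> recursive (fun v => f (g v)).
Proof.
move=> f_rec g_rec; apply: recursive_ext (recursive_comp f_rec (fun=> g_rec)) => v.
by rewrite /thead tnth_mktuple.
Qed.

Lemma recursive_comp2 n (f : nat -> nat -> nat) (g h : n.-tuple nat -> nat) :
  computable2 f -> recursive g -> recursive h -> recursive (fun v => f (g v) (h v)).
Proof.
move=> f_rec g_rec h_rec.
pose args (i : 'I_2) := if i == ord0 then g else h.
apply: recursive_ext (recursive_comp (g := args) f_rec _) => [v|i].
  by rewrite !tnth_mktuple.
by rewrite /args; case: ifP.
Qed.

Lemma recursive_const n c : recursive (fun _ : n.-tuple nat => c).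
Proof.
elim: c => [|c IH]; first exact: recursive_zero.
exact: (recursive_comp1 recursive_succ IH).
Qed.

Lemma computable2_rec (f : nat -> nat) (g F : nat -> nat -> nat) :
  computable f -> computable2 g ->
  (forall m, F 0 m = f m) -> (forall k m, F k.+1 m = g (F k m) m) -> computable2 F.
Proof.
move=> f_rec g_rec F0 FS.
pose step (v : 3.-tuple nat) := g (tnth v (inord 1)) (tnth v (inord 2)).
have step_rec : recursive step by apply: recursive_comp2 => //; apply: recursive_proj.
have rectE (w : 1.-tuple nat) k : nat_rect (fun=> nat) (f (thead w))
    (fun k r => step [tuple of k :: r :: w]) k = F k (thead w).
  elim: k => [|k IH] /=; first by rewrite F0.
  by rewrite FS -IH /step /thead; congr g; rewrite !(tnth_nth 0) /= !inordK.
apply: recursive_ext (recursive_prim f_rec step_rec) => v.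
by rewrite rectE /thead !(tnth_nth 0) /= nth_behead.
Qed.

Lemma computable2_addn : computable2 addn.
Proof.
apply: (@computable2_rec id (fun a _ => a.+1)) => //; first exact: recursive_proj.
exact: (recursive_comp1 recursive_succ (recursive_proj ord0)).
Qed.

Lemma computable2_muln : computable2 muln.
Proof.
apply: (@computable2_rec (fun=> 0) addn) => //.
- exact: recursive_zero.
- exact: computable2_addn.
by move=> k m; rewrite mulSn addnC.
Qed.

Lemma computable2_expn : computable2 expn.
Proof.
have flip_expn : computable2 (fun k m => m ^ k).
  apply: (@computable2_rec (fun=> 1) muln) => //.
  - exact: recursive_const.
  - exact: computable2_muln.
  by move=> k m; rewrite expnS mulnC.
exact: (recursive_comp2 flip_expn (recursive_proj ord_max) (recursive_proj ord0)).
Qed.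

Lemma computable_index_bound : computable index_bound.
Proof.
have id_rec : recursive (fun v : 1.-tuple nat => thead v) by exact: recursive_proj.
apply: (recursive_comp2 computable2_expn) => //.
apply: (recursive_comp2 computable2_muln); first exact: recursive_const.
by apply: (recursive_comp2 computable2_expn) => //; exact: recursive_const.
Qed.

End Computability.

Lemma coprime_fact m n : (forall p, prime p -> p <= n -> ~ p %| m) -> coprime m n`!.
Proof.
elim: n => [|n IH] ndvd; first exact: coprimen1.
rewrite factS coprimeMr IH ?andbT => [|p p_prime p_le]; last first.
  by apply: ndvd => //; exact: leqW.
apply: contraT => /negPf gcd_neq1; pose p := pdiv (gcdn m n.+1).
have p_prime : prime p.
  apply: pdiv_prime; rewrite ltn_neqAle eq_sym -/(coprime m n.+1) gcd_neq1.
  by rewrite gcdn_gt0 orbT.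
have := pdiv_dvd (gcdn m n.+1); rewrite -/p dvdn_gcd => /andP[p_m p_n].
by case: (ndvd p p_prime (dvdn_leq _ p_n)).
Qed.

Local Open Scope classical_set_scope.

Theorem theorem1 :
  (forall p : nat, prime p -> 3 <= p ->
     finite_set [set l : nat | 3 <= l /\
       exists e : algC, is_eps l e /\ p %| unit_index e])
  /\
  (exists lN : nat -> nat, computable lN /\
     forall N : nat, 2 <= N ->
     forall (l : nat) (e : algC), 3 <= l -> lN N <= l -> is_eps l e ->
       gcdn (unit_index e) N`! = 1).
Proof.
split=> [p p_prime _|].
  apply: (@sub_finite_set _ _ `I_(index_bound p)); last exact: finite_II.
  move=> l /= [_ [e [e_eps p_dvd]]]; rewrite ltnNge; apply/negP => l_ge.
  by apply: (prime_ndvd_unit_index p_prime l_ge _ p_dvd); apply/ennola_root_eps.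
exists index_bound; split=> [|N _ l e _ l_ge e_eps]; first exact: computable_index_bound.
apply/eqP/coprime_fact => p p_prime p_le; apply: (prime_ndvd_unit_index (l := l)) => //.
  by apply: leq_trans l_ge; apply: leq_index_bound; rewrite ?prime_gt0.
exact/ennola_root_eps.
Qed.
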